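(* Let $k$ be an infinite field, $A$ a finite-dimensional $k$-algebra and $K/k$ a finite separable field extension; regard $A\otimes_k K$ as a finite-dimensional $K$-algebra. Then the following hold. (1) For each $m>0$, $\mathbf{C}_m(A\text{-proj})$ is of finite representation type if and only if $\mathbf{C}_m(A\otimes_k K\text{-proj})$ is of finite representation type. (2) For each $m>0$, $\mathbf{C}_m(A\text{-proj})$ is of strongly unbounded type if and only if $\mathbf{C}_m(A\otimes_k K\text{-proj})$ is of strongly unbounded type. As a consequence, $A$ is $\mathbf{C}$-dichotomic if and only if $A\otimes_k K$ is $\mathbf{C}$-dichotomic.
   Context: Let $B$ be a finite-dimensional algebra over a field $F$ (used with $B=A$, $F=k$ and with $B=A\otimes_kK$, $F=K$). $B\text{-proj}$ denotes the category of finitely generated projective left $B$-modules and $\mathbf{C}^{b}(B\text{-proj})$ the category of bounded (cochain) complexes in it. A complex $X=(X^i,d^i)\in\mathbf{C}^b(B\text{-proj})$ is homotopy minimal if $\mathrm{Im}\, d^i\subseteq \mathrm{rad}\, X^{i+1}$ for all $i\in\mathbb{Z}$. For $m\ge 0$, $\mathbf{C}_m(B\text{-proj})$ is the full subcategory of $\mathbf{C}^b(B\text{-proj})$ of homotopy minimal complexes with $X^i=0$ for $i\notin\{0,1,\dots,m\}$. For a bounded complex $X$ of finite-dimensional $B$-modules (with nonzero cohomology), the cohomological range is $\mathrm{hr}_F(X)=\mathrm{hl}_F(X)\cdot \mathrm{hw}(X)$, where $\mathrm{hl}_F(X)=\max\{\dim_F H^i(X)\mid i\in\mathbb{Z}\}$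 and $\mathrm{hw}(X)=\max\{j-i+1\mid H^i(X)\neq 0\neq H^j(X)\}$. $\mathbf{C}_m(B\text{-proj})$ is of finite representation type if it has only finitely many indecomposable objects up to isomorphism. It is of strongly unbounded type if there is an increasing sequence $(r_i)_{i\in\mathbb{N}}\in\mathbb{N}^{\mathbb{N}}$ (i.e. $r_i<r_{i+1}$ for all $i$) such that for each $r_i$ there are, up to isomorphism, infinitely many indecomposable objects in $\mathbf{C}_m(B\text{-proj})$ with cohomological range $r_i$ (dimensions taken over $F$). $B$ is $\mathbf{C}$-dichotomic if either $\mathbf{C}_m(B\text{-proj})$ is of finite representation type for each $m\ge1$, or $\mathbf{C}_{m'}(B\text{-proj})$ is of strongly unbounded type for some $m'\ge1$. *)

(* Defs.v *)
From HB Require Import structures.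
From mathcomp Require Import all_boot all_order all_algebra all_field.

Set Implicit Arguments.
Unset Strict Implicit.
Unset Printing Implicit Defensive.

Import GRing.Theory Num.Theory.
Local Open Scope ring_scope.

Definition infinite_type (T : eqType) : Prop :=
  ~ exists s : seq T, forall x : T, x \in s.

(******************************************************************************)
(* The K-algebra A \otimes_k K.  With e := vbasis {:A}, an element is         *)
(* represented by its coordinates on the K-basis (e_i \otimes 1); [tens a x]  *)
(* is the pure tensor a \otimes x.  See tensM, tens11, tensZ and tens_univ.   *)
(******************************************************************************)
Section ScalarExtension.

Variables (k : fieldType) (A : falgType k) (K : fieldExtType k).

Definition scalar_ext : Type := 'rV[K]_(\dim {:A}).

HB.instance Definition _ := 
  Vector.copy scalar_ext 'rV[K]_(\dim {:A}).

Definition tens (a : A) (x : K) : scalar_ext :=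
  \row_i (coord (vbasis {:A}) i a *: x).

Let e (i : 'I_(\dim {:A})) : A := (vbasis {:A})`_i.

Definition scalar_ext_one : scalar_ext := tens 1 1.

Definition scalar_ext_mul (t u : scalar_ext) : scalar_ext :=
  \sum_i \sum_j tens (e i * e j) (t 0 i * u 0 j).

Let coord_e a : a = \sum_i coord (vbasis {:A}) i a *: e i.
Proof. exact/coord_vbasis/memvf. Qed.

Lemma tensDl a b x : tens (a + b) x = tens a x + tens b x.
Proof. by apply/rowP=> i; rewrite !mxE linearD scalerDl. Qed.

Lemma tensDr a x y : tens a (x + y) = tens a x + tens a y.
Proof. by apply/rowP=> i; rewrite !mxE scalerDr. Qed.

Lemma tensZl c a x : tens (c *: a) x = tens a (c *: x).
Proof. by apply/rowP=> i; rewrite !mxE linearZ /= mulrC -scalerA. Qed.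

Lemma tensZ (y : K) a x : y *: tens a x = tens a (y * x).
Proof. by apply/rowP=> i; rewrite !mxE scalerAr. Qed.

Lemma tens_suml I (r : seq I) (P : pred I) (F : I -> A) x :
  tens (\sum_(i <- r | P i) F i) x = \sum_(i <- r | P i) tens (F i) x.
Proof.
apply: (big_morph (fun a => tens a x)) => [a b|]; first exact: tensDl.
by rewrite -(scale0r 0) tensZl; apply/rowP=> i; rewrite !mxE scale0r scaler0.
Qed.

Lemma tens_sumr I (r : seq I) (P : pred I) a (F : I -> K) :
  tens a (\sum_(i <- r | P i) F i) = \sum_(i <- r | P i) tens a (F i).
Proof.
apply: (big_morph (tens a)) => [x y|]; first exact: tensDr.
by apply/rowP=> i; rewrite !mxE scaler0.
Qed.

Lemma scalar_ext_decomp (t : scalar_ext) : t = \sum_i tens (e i) (t 0 i).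
Proof.
apply/rowP=> j; rewrite summxE (bigD1 j) //= mxE.
have fe := basis_free (vbasisP {:A}).
rewrite coord_free // eqxx scale1r big1 ?addr0 // => i ij.
by rewrite mxE coord_free // (negPf ij) scale0r.
Qed.

Let mulDl : left_distributive scalar_ext_mul +%R.
Proof.
move=> t u v; rewrite -big_split; apply: eq_bigr => i _ /=.
by rewrite -big_split; apply: eq_bigr => j _; rewrite mxE mulrDl tensDr.
Qed.

Let mulDr : right_distributive scalar_ext_mul +%R.
Proof.
move=> t u v; rewrite -big_split; apply: eq_bigr => i _ /=.
by rewrite -big_split; apply: eq_bigr => j _; rewrite mxE mulrDr tensDr.
Qed.

Let mulZl y t u : y *: scalar_ext_mul t u = scalar_ext_mul (y *: t) u.
Proof.
rewrite scaler_sumr; apply: eq_bigr => i _; rewrite scaler_sumr.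
by apply: eq_bigr => j _; rewrite mxE tensZ mulrA.
Qed.

Let mulZr y t u : y *: scalar_ext_mul t u = scalar_ext_mul t (y *: u).
Proof.
rewrite scaler_sumr; apply: eq_bigr => i _; rewrite scaler_sumr.
by apply: eq_bigr => j _; rewrite mxE tensZ mulrCA.
Qed.

Let mul_tens a b x y :
  scalar_ext_mul (tens a x) (tens b y) = tens (a * b) (x * y).
Proof.
rewrite /scalar_ext_mul {2}(coord_e a) mulr_suml tens_suml.
apply: eq_bigr => i _; rewrite {2}(coord_e b) mulr_sumr tens_suml.
apply: eq_bigr => j _; rewrite !mxE -[in RHS]scalerAr -[in RHS]scalerAl !tensZl.
by rewrite -scalerAl -scalerAr.
Qed.

Let mul_suml I (r : seq I) (F : I -> scalar_ext) u :
  scalar_ext_mul (\sum_(i <- r) F i) u = \sum_(i <- r) scalar_ext_mul (F i) u.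
Proof.
apply: (big_morph (scalar_ext_mul^~ u)) => [s t|]; first exact: mulDl.
by rewrite -(scale0r 0) -mulZl !scale0r.
Qed.

Let mul_sumr I (r : seq I) (F : I -> scalar_ext) u :
  scalar_ext_mul u (\sum_(i <- r) F i) = \sum_(i <- r) scalar_ext_mul u (F i).
Proof.
apply: (big_morph (scalar_ext_mul u)) => [s t|]; first exact: mulDr.
by rewrite -(scale0r 0) -mulZr !scale0r.
Qed.

Let mulA : associative scalar_ext_mul.
Proof.
move=> t u v; rewrite (scalar_ext_decomp t) (scalar_ext_decomp u).
rewrite (scalar_ext_decomp v) !mul_suml; apply: eq_bigr => i _.
rewrite mul_sumr (mul_sumr _ (fun j => tens (e j) (u 0 j))) mul_suml.
apply: eq_bigr => j _.
by rewrite !mul_sumr; apply: eq_bigr => l _; rewrite !mul_tens !mulrA.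
Qed.

Let mul1 : left_id scalar_ext_one scalar_ext_mul.
Proof.
move=> t; rewrite [in LHS](scalar_ext_decomp t) mul_sumr.
rewrite [in RHS](scalar_ext_decomp t); apply: eq_bigr => i _.
by rewrite mul_tens !mul1r.
Qed.

Let mulr1 : right_id scalar_ext_one scalar_ext_mul.
Proof.
move=> t; rewrite [in LHS](scalar_ext_decomp t) mul_suml.
rewrite [in RHS](scalar_ext_decomp t); apply: eq_bigr => i _.
by rewrite mul_tens !mulr1.
Qed.

Let one_neq0 : scalar_ext_one != 0.
Proof.
apply/eqP=> /rowP h; have /eqP[] := oner_neq0 A.
rewrite (coord_e 1) big1 // => i _; have /eqP := h i.
by rewrite !mxE scaler_eq0 oner_eq0 orbF => /eqP->; rewrite scale0r.
Qed.

HB.instance Definition _ := GRing.Zmodule_isNzRing.Build scalar_ext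
  mulA mul1 mulr1 mulDl mulDr one_neq0.
HB.instance Definition _ := GRing.Lmodule_isLalgebra.Build K scalar_ext mulZl.
HB.instance Definition _ := GRing.Lalgebra_isAlgebra.Build K scalar_ext mulZr.
HB.instance Definition _ := Algebra_isFalgebra.Build K scalar_ext.

Lemma tens11 : tens 1 1 = 1 :> scalar_ext.
Proof. by []. Qed.

Lemma tensM a b x y : tens a x * tens b y = tens (a * b) (x * y).
Proof. exact: mul_tens. Qed.

(* [tens] is the universal k-bilinear map on A x K. *)
Lemma tens_univ (V : lmodType k) (f : A -> K -> V) :
    (forall x, linear (f^~ x)) -> (forall a, linear (f a)) ->
  exists2 g : scalar_ext -> V,
    (forall t u, g (t + u) = g t + g u) /\ (forall a x, g (tens a x) = f a x)
  & forall g' : scalar_ext -> V,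
      (forall t u, g' (t + u) = g' t + g' u) ->
      (forall a x, g' (tens a x) = f a x) -> g' =1 g.
Proof.
move=> fl fr.
have f0 x : f 0 x = 0.
  by have := fl x (-1) 0 0; rewrite scaler0 addr0 scaleN1r addNr.
have fZl c a x : f (c *: a) x = c *: f a x.
  by have := fl x c a 0; rewrite /= f0 !addr0.
have fDl a b x : f (a + b) x = f a x + f b x.
  by have := fl x 1 a b; rewrite /= !scale1r.
have fr0 a : f a 0 = 0.
  by have := fr a (-1) 0 0; rewrite scaler0 addr0 scaleN1r addNr.
have fZr c a x : f a (c *: x) = c *: f a x.
  by have := fr a c x 0; rewrite fr0 !addr0.
have fDr a x y : f a (x + y) = f a x + f a y.
  by have := fr a 1 x y; rewrite !scale1r.
exists (fun t => \sum_i f (e i) (t 0 i)); first split=> [t u|a x].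
- by rewrite -big_split; apply: eq_bigr => i _; rewrite mxE fDr.
- rewrite {2}(coord_e a) (big_morph (f^~ x) (fun a b => fDl a b x) (f0 x)).
  by apply: eq_bigr => i _; rewrite mxE fZr fZl.
move=> g' gD gt t.
have g0 : g' 0 = 0 by apply: (addIr (g' 0)); rewrite -gD !add0r.
rewrite {1}(scalar_ext_decomp t) (big_morph g' gD g0).
by apply: eq_bigr => i _; rewrite gt.
Qed.

End ScalarExtension.

Section Modules.

Variable B : nzRingType.

Definition fin_generated (M : lmodType B) : Prop :=
  exists n (e : 'I_n -> M),
    forall x, exists c : 'I_n -> B, x = \sum_i c i *: e i.

Definition projective (P : lmodType B) : Prop :=
  forall (M N : lmodType B) (g : {linear M -> N}) (f : {linear P -> N}),
    (forall y, exists x, g x = y) ->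
    exists h : {linear P -> M}, forall x, g (h x) = f x.

Definition maximal_submod (M : lmodType B) (N : {pred M}) : Prop :=
  [/\ submod_closed N,
      ~ (forall x, x \in N)
    & forall N' : {pred M}, submod_closed N' -> {subset N <= N'} ->
        {subset N' <= N} \/ (forall x, x \in N')].

Definition in_rad (M : lmodType B) (x : M) : Prop :=
  forall N : {pred M}, maximal_submod N -> x \in N.

End Modules.

(******************************************************************************)
(* Cochain complexes of left B-modules.  To avoid casts between X (i - 1 + 1) *)
(* and X i, a differential X i -> X j is given for all i and j, and is 0      *)
(* unless j = i + 1; the differential d^i is [cdiff X i (i + 1)].             *)
(******************************************************************************)
Record complex (B : nzRingType) := Complex {
  cobj :> int -> lmodType B;
  cdiff : forall i j : int, {linear cobj i -> cobj j};
  cdiff_shape : forall i j, j != i + 1 -> forall x, cdiff i j x = 0;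
  cdiffK : forall i j l x, cdiff j l (cdiff i j x) = 0
}.

Section DirectSum.

Variables (B : nzRingType) (X Y : complex B).

Definition dsum_obj (i : int) : lmodType B := (X i * Y i)%type.

Definition dsum_diff (i j : int) (u : dsum_obj i) : dsum_obj j :=
  (cdiff X i j u.1, cdiff Y i j u.2).

Let dsum_diff_linear i j : linear (@dsum_diff i j).
Proof. by move=> a u v; rewrite /dsum_diff !linearP. Qed.

HB.instance Definition _ i j :=
  GRing.isLinear.Build B (dsum_obj i) (dsum_obj j) *:%R (@dsum_diff i j)
    (@dsum_diff_linear i j).

Let dsum_shape i j : j != i + 1 -> forall u, @dsum_diff i j u = 0.
Proof. by move=> ij u; rewrite /dsum_diff !cdiff_shape. Qed.

Let dsum_diffK i j l u : @dsum_diff j l (@dsum_diff i j u) = 0.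
Proof. by rewrite /dsum_diff /= !cdiffK. Qed.

Definition dsum : complex B :=
  @Complex B dsum_obj (fun i j => @dsum_diff i j) dsum_shape dsum_diffK.

End DirectSum.

Section Complexes.

Variable B : nzRingType.
Implicit Types X Y Z : complex B.

Record chain_map X Y := ChainMap {
  cmap :> forall i : int, {linear X i -> Y i};
  cmapE : forall i j x, cmap j (cdiff X i j x) = cdiff Y i j (cmap i x)
}.

Definition iso X Y : Prop :=
  exists (f : chain_map X Y) (g : chain_map Y X),
    forall i, cancel (f i) (g i) /\ cancel (g i) (f i).

Definition is_zero X : Prop := forall i (x : X i), x = 0.

(* X is an object of C^b(B-proj) *)
Definition in_Cb X : Prop :=
  (forall i, fin_generated (X i) /\ projective (X i)) /\
  (exists a b : int, forall i, ~~ (a <= i <= b) -> forall x : X i, x = 0).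

Definition homotopy_minimal X : Prop :=
  forall i (x : X i), in_rad (cdiff X i (i + 1) x).

(* X is an object of C_m(B-proj) *)
Definition in_Cm (m : nat) X : Prop :=
  [/\ in_Cb X,
      homotopy_minimal X
    & forall i, ~~ (0 <= i <= m%:Z) -> forall x : X i, x = 0].

Definition indecomposable_in_Cm (m : nat) X : Prop :=
  [/\ in_Cm m X,
      ~ is_zero X
    & forall Y Z, in_Cm m Y -> in_Cm m Z -> iso X (dsum Y Z) ->
        is_zero Y \/ is_zero Z].

Definition finitely_many_up_to_iso (P : complex B -> Prop) : Prop :=
  exists n (L : 'I_n -> complex B), forall X, P X -> exists i, iso X (L i).

Definition finite_rep_type (m : nat) : Prop :=
  finitely_many_up_to_iso (indecomposable_in_Cm m).

Definition cocycle X (i : int) (x : X i) : Prop := cdiff X i (i + 1) x = 0.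

Definition coboundary X (i : int) (x : X i) : Prop :=
  exists y : X (i - 1), cdiff X (i - 1) i y = x.

(* H^i(X) != 0 *)
Definition coh_neq0 X (i : int) : Prop :=
  exists2 x : X i, cocycle x & ~ coboundary x.

End Complexes.

Definition is_max (P : nat -> Prop) (n : nat) : Prop :=
  P n /\ forall p, P p -> (p <= n)%N.

(* F acts on a B-module M through F -> B, i.e. c acts on v as c%:A *: v.      *)
(* The invariants below are stated as relations "the value is n".             *)
Section CohomologicalRange.

Variables (F : fieldType) (B : falgType F).
Implicit Types X : complex B.

(* dim_F H^i(X) = n: the classes of the e s form an F-basis of H^i(X). *)
Definition coh_dim X (i : int) (n : nat) : Prop :=
  exists2 e : 'I_n -> X i,
    forall s, cocycle (e s)
  & forall x : X i, cocycle x ->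
      exists! c : {ffun 'I_n -> F},
        coboundary (x - \sum_s ((c s)%:A : B) *: e s).

Definition hl X : nat -> Prop := is_max (fun n => exists i, coh_dim X i n).

Definition hw X : nat -> Prop :=
  is_max (fun n => exists i j : int,
    [/\ coh_neq0 X i, coh_neq0 X j & n%:Z = j - i + 1]).

Definition hr X (r : nat) : Prop :=
  exists h w : nat, [/\ hl X h, hw X w & r = (h * w)%N].

Definition strongly_unbounded (m : nat) : Prop :=
  exists2 r : nat -> nat,
    forall i, (r i < r i.+1)%N
  & forall i, ~ finitely_many_up_to_iso
        (fun X => indecomposable_in_Cm m X /\ hr X (r i)).

End CohomologicalRange.

Definition C_dichotomic (F : fieldType) (B : falgType F) : Prop :=
  (forall m, (1 <= m)%N -> finite_rep_type B m) \/
  (exists2 m, (1 <= m)%N & strongly_unbounded B m).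

(* Main.v *)
From mathcomp Require Import boolp.
Require Import Defs.
From HB Require Import structures.
From mathcomp Require Import all_boot all_order all_algebra all_field ring.

(** Put B = A \otimes_k K and n = [K : k]. Restriction R from B to A and extension E = Hom_k(K, -)
    (isomorphic to - \otimes_k K) act on complexes. Every X is a retract of R E X, and, averaging
    with a separability idempotent of K / k, every Y is a retract of E R Y. The same averaging
    shows that E and R preserve projectivity and radicals, hence C_m; both leave the support of
    the cohomology unchanged and multiply its dimensions at most by n.

    In C_m, endomorphisms of indecomposables are local (Fitting), so an indecomposable retract of a
    direct sum is a retract of a summand. Thus every indecomposable Y is a retract of E X for an
    indecomposable retract X of R Y, which transfers finite type. For indecomposable X choose
    likewise an indecomposable retract Z of E X with X a retract of R Z: the cohomological ranges
    of X and Z differ at most by the factor n in either direction, so by the pigeonhole principle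
    infinitely many X of range r produce infinitely many Z of a common range r' >= r / n.
    The two directions of each equivalence are symmetric in E and R. *)

Set Implicit Arguments.
Unset Strict Implicit.
Unset Printing Implicit Defensive.

Import GRing.Theory Num.Theory.
Local Open Scope ring_scope.

(** * Submodules, radicals and independent families *)

Section Submodules.

Variable B : nzRingType.
Implicit Types M N : lmodType B.

(** Predicates are [Prop]-valued so that sums, images and kernels need no decision procedure;
    [in_radP] links them to the boolean predicates of [in_rad]. *)
Definition submodule M (N : M -> Prop) : Prop :=
  N 0 /\ forall a x y, N x -> N y -> N (a *: x + y).

Section Closure.

Variables (M : lmodType B) (N : M -> Prop).
Hypothesis sN : submodule N.

Lemma submod0 : N 0. Proof. by case: sN. Qed.

Lemma submodD x y : N x -> N y -> N (x + y).
Proof. by move=> Nx Ny; rewrite -(scale1r x); apply: (proj2 sN). Qed.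

Lemma submodZ a x : N x -> N (a *: x).
Proof. by move=> Nx; rewrite -(addr0 (_ *: _)); apply: (proj2 sN) => //; apply: submod0. Qed.

Lemma submodN x : N x -> N (- x).
Proof. by move=> Nx; rewrite -scaleN1r; apply: submodZ. Qed.

Lemma submodB x y : N x -> N y -> N (x - y).
Proof. by move=> Nx Ny; apply: submodD => //; apply: submodN. Qed.

Lemma submod_sum I (r : seq I) (P : pred I) (f : I -> M) :
  (forall i, P i -> N (f i)) -> N (\sum_(i <- r | P i) f i).
Proof.
by move=> Nf; elim/big_ind: _ => //; [apply: submod0 | apply: submodD].
Qed.

Lemma submod_shift x y : N (x - y) -> N y -> N x.
Proof. by move=> Nxy Ny; rewrite -(subrK y x); apply: submodD. Qed.

Lemma submod_closed_asbool : submod_closed [pred x : M | `[<N x>]].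
Proof.
split=> [|a x y]; rewrite !inE; first exact/asboolP/submod0.
by move=> /asboolP Nx /asboolP Ny; apply/asboolP; apply: (proj2 sN).
Qed.

End Closure.

Lemma submodule_closed M (N : {pred M}) :
  submod_closed N -> submodule (fun x => x \in N).
Proof. by case=> N0 NZ; split=> // a x y; apply: NZ. Qed.

Lemma submodule_preim M M' (f : {linear M -> M'}) (N : M' -> Prop) :
  submodule N -> submodule (fun x => N (f x)).
Proof.
move=> sN; split=> [|a x y Nx Ny]; first by rewrite linear0; apply: submod0.
by rewrite linearP; apply: (proj2 sN).
Qed.

Definition submod_add M (N N' : M -> Prop) (x : M) : Prop :=
  exists2 y, N y & N' (x - y).

Lemma submodule_add M (N N' : M -> Prop) :
  submodule N -> submodule N' -> submodule (submod_add N N').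
Proof.
move=> sN sN'; split=> [|a x x' [y Ny N'y] [y' Ny' N'y']].
  by exists 0; [apply: submod0 | rewrite subr0; apply: submod0].
exists (a *: y + y'); first by apply: (proj2 sN).
by rewrite opprD addrACA -scalerBr; apply: (proj2 sN').
Qed.

Definition maximal M (N : M -> Prop) : Prop :=
  [/\ submodule N, exists x, ~ N x
    & forall N' : M -> Prop, submodule N' -> (forall x, N x -> N' x) ->
        (exists2 x, N' x & ~ N x) -> forall x, N' x].

Lemma in_radP M (x : M) : in_rad x <-> forall N : M -> Prop, maximal N -> N x.
Proof.
split=> [radx N [sN [y nNy] maxN]|radx N [sN nN maxN]].
  suff: x \in [pred x : M | `[<N x>]] by rewrite inE => /asboolP.
  apply: radx; split; first exact: submod_closed_asbool.
    by move=> /(_ y); rewrite inE => /asboolP.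
  move=> N' sN' NN'; have [[z N'z nNz]|nex] := pselect (exists2 x, x \in N' & ~ N x).
    right; apply: (maxN _ (submodule_closed sN')); last by exists z.
    by move=> t Nt; apply: NN'; rewrite inE; apply/asboolP.
  left=> t N't; rewrite inE; apply/asboolP.
  by have [//|nNt] := pselect (N t); case: nex; exists t.
apply: (radx (fun x => x \in N)); split; first exact: submodule_closed.
  by apply: contrapT => nex; apply: nN => y; apply: contrapT => nNy; apply: nex; exists y.
move=> N' sN' NN' [y N'y nNy] z.
have [|N'N|allN'] := maxN [pred x : M | `[<N' x>]] (submod_closed_asbool sN').
- by move=> t /NN' N't; rewrite inE; apply/asboolP.
- by case: nNy; apply: N'N; rewrite inE; apply/asboolP.
by have := allN' z; rewrite inE => /asboolP.
Qed.

Lemma in_rad_submodule M : submodule (@in_rad B M).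
Proof.
split=> [|a x y /in_radP radx /in_radP rady]; apply/in_radP => N maxN.
  by case: maxN => sN _ _; apply: submod0.
by case: (maxN) => sN _ _; apply: (proj2 sN); [apply: radx | apply: rady].
Qed.

(* The preimage of a maximal submodule is everything or again maximal. *)
Lemma in_rad_map M M' (f : {linear M -> M'}) x : in_rad x -> in_rad (f x).
Proof.
move=> /in_radP radx; apply/in_radP => N maxN; case: (maxN) => sN _ mN.
apply: contrapT => nNfx; apply: (nNfx); apply: (radx (fun x => N (f x))).
split; [exact: submodule_preim | by exists x |].
move=> N' sN' NN' [y N'y nNfy] z.
pose fN' t := exists2 t', N' t' & t = f t'.
have sfN' : submodule fN'.
  split=> [|a _ _ [t N't ->] [u N'u ->]].
    by exists 0; [apply: submod0 | rewrite linear0].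
  by exists (a *: t + u); [apply: (proj2 sN') | rewrite linearP].
(* The submodule f(N') + N strictly contains N, because of [f y], hence contains [f z]. If f z = f t
   modulo N with t in N', then z - t lies in the preimage of N, hence in N'. *)
have [||_ [t N't ->] Nzt] := mN _ (submodule_add sfN' sN) _ _ (f z).
- by move=> t Nt; exists 0; [apply: submod0 | rewrite subr0].
- exists (f y) => //; exists (f y); first by exists y.
  by rewrite subrr; apply: submod0.
by apply: (submod_shift sN' _ N't); apply: NN'; rewrite linearB.
Qed.

End Submodules.

(** * Linear algebra modulo a subspace *)

Section LinearAlgebra.

Variables (F : fieldType) (V : lmodType F) (D : V -> Prop).
Hypothesis sD : submodule D.

Definition indep_mod n (e : 'I_n -> V) : Prop :=
  forall c : 'I_n -> F, D (\sum_s c s *: e s) -> forall s, c s = 0.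

Definition spans_mod n (e : 'I_n -> V) (x : V) : Prop :=
  exists c : 'I_n -> F, D (x - \sum_s c s *: e s).

(** The matrix expressing [e] through [g] modulo [D] has independent rows, since a row vector that
    it kills is a relation between the [e s] modulo [D]; so its rank n is at most its number N of
    columns. *)
Lemma indep_leq_span n (e : 'I_n -> V) N (g : 'I_N -> V) :
  indep_mod e -> (forall s, spans_mod g (e s)) -> (n <= N)%N.
Proof.
move=> indep_e /fin_all_exists[c Dc].
pose A := \matrix_(s, t) c s t.
suff /eqP <- : row_free A by apply: rank_leq_col.
apply: inj_row_free => v vA0; apply/rowP => s; rewrite mxE.
apply: (indep_e (fun s => v 0 s)).
have : D (\sum_s (v 0 s *: e s - v 0 s *: \sum_t c s t *: g t)).
  by apply: (submod_sum sD) => s' _; rewrite -scalerBr; apply: submodZ.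
rewrite sumrB [X in _ - X](_ : _ = 0) ?subr0 //.
under eq_bigr => t _ do rewrite scaler_sumr.
rewrite exchange_big big1 //= => t _.
under eq_bigr => u _ do rewrite scalerA.
rewrite -scaler_suml; suff -> : \sum_i v 0 i * c i t = (v *m A) 0 t.
  by rewrite vA0 mxE scale0r.
by rewrite mxE; apply: eq_bigr => u _; rewrite mxE.
Qed.

Lemma indep_extend n (e : 'I_n -> V) x :
  indep_mod e -> ~ spans_mod e x ->
  indep_mod (fun s : 'I_n.+1 => oapp e x (unlift ord0 s)).
Proof.
move=> indep_e nx c; rewrite big_ord_recl unlift_none /=.
under eq_bigr => s _ do rewrite liftK /=.
move=> Dc; have c0 : c ord0 = 0.
  apply: contrapT => /eqP c0; apply: nx.
  exists (fun s => - ((c ord0)^-1 * c (lift ord0 s))).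
  have := submodZ sD (c ord0)^-1 Dc.
  rewrite scalerDr scalerA mulVf // scale1r scaler_sumr -sumrN.
  by under [X in D (_ + X) -> _]eq_bigr => s _ do rewrite scalerA -[_ * _]opprK scaleNr.
move=> s; case: (unliftP ord0 s) => [t ->|->] //.
by apply: (indep_e (fun s => c (lift ord0 s))); move: Dc; rewrite c0 scale0r add0r.
Qed.

(** An independent family in [Z] of greatest length spans [Z], since otherwise [indep_extend]
    lengthens it; the bound makes a greatest length exist. *)
Lemma basis_exists (Z : V -> Prop) N :
  (forall n (e : 'I_n -> V), (forall s, Z (e s)) -> indep_mod e -> (n <= N)%N) ->
  exists n (e : 'I_n -> V),
    [/\ forall s, Z (e s), indep_mod e & forall x, Z x -> spans_mod e x].
Proof.
move=> bound.
pose P n := `[<exists2 e : 'I_n -> V, forall s, Z (e s) & indep_mod e>].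
have P0 : exists n, P n.
  by exists 0%N; apply/asboolP; exists (fun=> 0) => [[]|c _ []].
have ubP n : P n -> (n <= N)%N by move=> /asboolP[e]; apply: bound.
case: (ex_maxnP P0 ubP) => n /asboolP[e Ze indep_e] maxn.
exists n, e; split=> // x Zx; apply: contrapT => nx.
suff /maxn : P n.+1 by rewrite ltnn.
apply/asboolP; exists (fun s : 'I_n.+1 => oapp e x (unlift ord0 s)).
  by move=> s; case: (unlift _ _).
exact: indep_extend.
Qed.

End LinearAlgebra.

Lemma sum_enum_val (T : finType) (V : nmodType) (f : T -> V) :
  \sum_(s < #|T|) f (enum_val s) = \sum_t f t.
Proof. by rewrite [RHS](reindex (@enum_val T T)) //; apply/onW_bij/enum_val_bij. Qed.

(** * Restriction of scalars and finite dimension *)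

Definition restr (R S : nzRingType) (phi : {rmorphism R -> S})
  (M : lmodType S) : Type := M.

Section Restriction.

Variables (R S : nzRingType) (phi : {rmorphism R -> S}) (M : lmodType S).

HB.instance Definition _ := GRing.Zmodule.copy (restr phi M) M.

Definition restr_scale (a : R) (x : restr phi M) : restr phi M := phi a *: (x : M).

Fact restr_scaleA a b x : restr_scale a (restr_scale b x) = restr_scale (a * b) x.
Proof. by rewrite /restr_scale scalerA -rmorphM. Qed.
Fact restr_scale1 : left_id 1 restr_scale.
Proof. by move=> x; rewrite /restr_scale rmorph1 scale1r. Qed.
Fact restr_scaleDr : right_distributive restr_scale +%R.
Proof. by move=> a x y; rewrite /restr_scale scalerDr. Qed.
Fact restr_scaleDl x : {morph restr_scale^~ x : a b / a + b}.
Proof. by move=> a b; rewrite /restr_scale rmorphD scalerDl. Qed.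

HB.instance Definition _ := GRing.Zmodule_isLmodule.Build R (restr phi M)
  restr_scaleA restr_scale1 restr_scaleDr restr_scaleDl.

Lemma restrE a (x : restr phi M) : a *: x = (phi a *: (x : M) : M).
Proof. by []. Qed.

End Restriction.

Section RestrictionMap.

Variables (R S : nzRingType) (phi : {rmorphism R -> S}) (M N : lmodType S).
Variable f : {linear M -> N}.

Definition restr_map (x : restr phi M) : restr phi N := f x.

Fact restr_map_linear : linear restr_map.
Proof. by move=> a x y; rewrite /restr_map !restrE linearP. Qed.

HB.instance Definition _ :=
  GRing.isLinear.Build R (restr phi M) (restr phi N) *:%R restr_map restr_map_linear.

End RestrictionMap.

Section FiniteDimension.

Variables (F : fieldType) (B : falgType F).
Implicit Types M : lmodType B.

(** The action is by conversion the one written out in [coh_dim], so linear algebra over F applies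
    to cohomology. *)
Definition fmod M : lmodType F := restr (GRing.in_alg B) M.

Lemma fmodE M c (x : fmod M) : c *: x = (c%:A *: (x : M) : M).
Proof. by []. Qed.

Lemma submodule_fmod M (N : M -> Prop) :
  submodule N -> submodule (N : fmod M -> Prop).
Proof. by case=> N0 NZ; split=> // a x y; apply: NZ. Qed.

Lemma submodule_eq0 (R : nzRingType) (M : lmodType R) : submodule (fun x : M => x = 0).
Proof. by split=> // a x y -> ->; rewrite scaler0 addr0. Qed.

Lemma fin_generated_span M : fin_generated M ->
  exists N (g : 'I_N -> fmod M), forall x, exists c : 'I_N -> F, x = \sum_s c s *: g s.
Proof.
case=> n [e spane].
pose T : finType := ('I_(\dim {:B}) * 'I_n)%type.
exists #|T|, (fun s : 'I_#|T| => let t : T := enum_val s in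
  (vbasis {:B})`_t.1 *: e t.2) => x.
have [c ->] := spane x.
exists (fun s => let t : T := enum_val s in coord (vbasis {:B}) t.1 (c t.2)).
rewrite (sum_enum_val (fun t : T => coord (vbasis {:B}) t.1 (c t.2) *:
  (((vbasis {:B})`_t.1 *: e t.2) : fmod M))).
rewrite -(pair_bigA _ (fun (i : 'I_(\dim {:B})) (j : 'I_n) =>
  coord (vbasis {:B}) i (c j) *: (((vbasis {:B})`_i *: e j) : fmod M))) exchange_big /=.
apply: eq_bigr => j _; rewrite {1}(coord_vbasis (memvf (c j))) scaler_suml.
by apply: eq_bigr => i _; rewrite fmodE scalerA mulr_algl.
Qed.

Lemma linear_comb (M N : lmodType B) (f : {linear M -> N}) n (c : 'I_n -> F)
    (e : 'I_n -> fmod M) :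
  f (\sum_s c s *: e s) = \sum_s c s *: (f (e s) : fmod N).
Proof.
rewrite -[LHS]/(restr_map (phi := GRing.in_alg B) f _) linear_sum.
by apply: eq_bigr => s _; rewrite linearZ.
Qed.

(** Finite dimension replaces Zorn's lemma: among the proper submodules above [W], take one
    containing an F-independent family of greatest length. A strictly larger proper submodule would
    contain a longer family. *)
Lemma proper_sub_maximal M (W : M -> Prop) :
  fin_generated M -> submodule W -> (exists x, ~ W x) ->
  exists2 N : M -> Prop, maximal N & forall x, W x -> N x.
Proof.
move=> /fin_generated_span[d [g spang]] sW [x0 nWx0].
pose good (N : M -> Prop) :=
  [/\ submodule N, exists x, ~ N x & forall x, W x -> N x].
pose P n := `[<exists N, good N /\ exists2 e : 'I_n -> fmod M,
  forall s, N (e s) & indep_mod (fun x => x = 0) e>].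
have P0 : exists n, P n.
  exists 0%N; apply/asboolP; exists W; split; first by split=> //; exists x0.
  by exists (fun=> 0) => [[]|c _ []].
have ubP n : P n -> (n <= d)%N.
  move=> /asboolP[N [_ [e _ indep_e]]].
  apply: (indep_leq_span (submodule_eq0 _) indep_e (g := g)) => s.
  by have [c ec] := spang (e s); exists c; rewrite {1}ec subrr.
case: (ex_maxnP P0 ubP) => n /asboolP[N [[sN nN WN] [e Ne indep_e]]] maxn.
exists N => //; split=> // N' sN' NN' [y N'y nNy].
apply: contrapT => /existsNP[z nN'z].
suff /maxn : P n.+1 by rewrite ltnn.
apply/asboolP; exists N'; split; first by split=> //; [exists z | move=> x /WN/NN'].
exists (fun s => oapp e y (unlift ord0 s)).
  by move=> s; case: (unlift _ _) => //= t; apply: NN'.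
apply: (indep_extend (submodule_eq0 _)) => // -[c /eqP]; rewrite subr_eq0 => /eqP yc.
by apply: nNy; rewrite yc; apply: (submod_sum (submodule_fmod sN)) => s _;
  apply: (submodZ (submodule_fmod sN)).
Qed.

End FiniteDimension.

(** * Polynomials in an endomorphism *)

Section PolynomialEndo.

Variables (F : fieldType) (B : falgType F) (M : lmodType B) (f : {linear M -> M}).

(** This is p(f). It is B-linear because the image of F in B is central ([algZC]). *)
Definition poly_endo (p : {poly F}) (x : M) : M :=
  \sum_(i < size p) (p`_i)%:A *: iter i f x.

Lemma poly_endoE n (p : {poly F}) x : (size p <= n)%N ->
  poly_endo p x = \sum_(i < n) (p`_i)%:A *: iter i f x.
Proof.
move=> le_pn; rewrite /poly_endo (big_ord_widen n (fun i => (p`_i)%:A *: iter i f x)) //.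
rewrite big_mkcond; apply: eq_bigr => i _; case: ltnP => // le_pi.
by rewrite nth_default // scale0r scale0r.
Qed.

Lemma iter_linearP i : linear (iter i f).
Proof. by elim: i => // i IHi a x y; rewrite /= IHi linearP. Qed.

Lemma algZC c (a : B) (x : M) : c%:A *: (a *: x) = a *: (c%:A *: x).
Proof. by rewrite !scalerA mulr_algl mulr_algr. Qed.

Fact poly_endo_linear p : linear (poly_endo p).
Proof.
move=> a x y; rewrite /poly_endo scaler_sumr -big_split; apply: eq_bigr => i _ /=.
by rewrite iter_linearP scalerDr algZC.
Qed.

HB.instance Definition _ p :=
  GRing.isLinear.Build B M M *:%R (poly_endo p) (poly_endo_linear p).

Lemma poly_endoD p q x : poly_endo (p + q) x = poly_endo p x + poly_endo q x.
Proof.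
have szp := leq_maxl (size p) (size q); have szq := leq_maxr (size p) (size q).
rewrite (poly_endoE _ szp) (poly_endoE _ szq) (poly_endoE _ (size_polyD p q)).
by rewrite -big_split; apply: eq_bigr => i _; rewrite coefD scalerDl scalerDl.
Qed.

Lemma poly_endoMX p x : poly_endo (p * 'X) x = poly_endo p (f x).
Proof.
rewrite (poly_endoE (n := (size p).+1)); last first.
  by rewrite (leq_trans (size_polyMleq _ _)) // size_polyX addn2.
rewrite big_ord_recl coefMX scale0r scale0r add0r; apply: eq_bigr => i _.
by rewrite coefMX -iterSr.
Qed.

Lemma poly_endoC c x : poly_endo c%:P x = c%:A *: x.
Proof.
by rewrite (poly_endoE (n := 1)) ?size_polyC ?leq_b1 // big_ord1 coefC.
Qed.

Lemma poly_endo1 x : poly_endo 1 x = x.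
Proof. by rewrite poly_endoC !scale1r. Qed.

Lemma poly_endoX x : poly_endo 'X x = f x.
Proof. by rewrite -[in LHS](mul1r 'X) poly_endoMX poly_endo1. Qed.

Lemma poly_endo_comm p x : poly_endo p (f x) = f (poly_endo p x).
Proof.
rewrite /poly_endo linear_sum; apply: eq_bigr => i _.
by rewrite linearZ -iterSr.
Qed.

Lemma poly_endoM p q x : poly_endo (p * q) x = poly_endo p (poly_endo q x).
Proof.
elim/poly_ind: p x => [|p c IHp] x.
  by rewrite mul0r /poly_endo !size_poly0 !big_ord0.
rewrite mulrDl !poly_endoD poly_endoC -mulrA ['X * q]mulrC mulrA !poly_endoMX IHp.
rewrite poly_endo_comm; congr (_ + _).
rewrite mulrC (_ : q * c%:P = c *: q); last by rewrite mulrC mul_polyC.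
rewrite (poly_endoE _ (size_scale_leq c q)) [in RHS]/poly_endo scaler_sumr.
by apply: eq_bigr => i _; rewrite coefZ scalerA mulr_algl scalerA.
Qed.

(** Cayley-Hamilton for a matrix describing f on a spanning, possibly dependent, family: its
    characteristic polynomial kills every generator. *)
Lemma poly_endo_annihilated : fin_generated M ->
  exists2 q, q != 0 & forall x, poly_endo q x = 0.
Proof.
move=> /fin_generated_span[n [g spang]].
(* Prepending the zero vector gives the matrices positive size, so that they form a nonzero ring. *)
pose g' (s : 'I_n.+1) : fmod M := oapp g 0 (unlift ord0 s).
have spang' x : exists c : 'I_n.+1 -> F, x = \sum_s c s *: g' s.
  have [c {1}->] := spang x; exists (fun s => oapp c 0 (unlift ord0 s)).
  rewrite big_ord_recl {1}/g' unlift_none scaler0 add0r.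
  by apply: eq_bigr => s _; rewrite /g' liftK.
have /fin_all_exists[C CE] s := spang' (f (g' s)).
pose A := \matrix_(s, t) C s t.
have itA i s : iter i f (g' s) = \sum_t (A ^+ i) s t *: g' t.
  elim: i => [|i IHi] /=.
    rewrite expr0 (bigD1 s) //= !mxE eqxx scale1r big1 ?addr0 // => t ts.
    by rewrite mxE eq_sym (negPf ts) scale0r.
  rewrite IHi linear_comb exprSr.
  under [LHS]eq_bigr => t _ do rewrite CE scaler_sumr.
  rewrite exchange_big; apply: eq_bigr => u _ /=; rewrite mxE scaler_suml.
  by apply: eq_bigr => t _; rewrite mxE scalerA.
have pA p s : poly_endo p (g' s) = \sum_t (horner_mx A p) s t *: g' t.
  rewrite /poly_endo; under eq_bigr => i _ do rewrite itA -fmodE scaler_sumr.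
  rewrite exchange_big; apply: eq_bigr => t _ /=.
  have -> : horner_mx A p = \sum_(i < size p) p`_i *: A ^+ i.
    rewrite -{1}[p]coefK poly_def raddf_sum; apply: eq_bigr => i _.
    by rewrite /= linearZ rmorphXn /= horner_mx_X.
  rewrite summxE scaler_suml; apply: eq_bigr => i _; rewrite mxE scalerA //.
exists (char_poly A); first by rewrite monic_neq0 ?char_poly_monic.
move=> x; have [c ->] := spang' x; rewrite linear_comb big1 // => s _.
rewrite /= pA Cayley_Hamilton big1 ?scaler0 // => t _.
by rewrite mxE scale0r.
Qed.

End PolynomialEndo.

(** * Retracts and splitting of idempotents in complexes *)

Section Fixed.

Variables (R : nzRingType) (M : lmodType R) (e : {linear M -> M}).

Definition fixed_pred : {pred M} := [pred x | e x == x].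

Fact fixed_submod_closed : submod_closed fixed_pred.
Proof.
split=> [|a x y]; rewrite !inE ?linear0 // => /eqP ex /eqP ey.
by rewrite linearP ex ey.
Qed.

HB.instance Definition _ := GRing.isSubmodClosed.Build R M fixed_pred
  fixed_submod_closed.

(** For idempotent [e] the fixed points are the image of [e], so this type splits [e]. *)
Record fixed := Fixed { fixed_val : M; fixed_valP : fixed_val \in fixed_pred }.

HB.instance Definition _ := [isSub for fixed_val].
HB.instance Definition _ := [Choice of fixed by <:].
HB.instance Definition _ := [SubChoice_isSubLmodule of fixed by <:].

Lemma fixed_valE (x : fixed) : e (val x) = val x.
Proof. by apply/eqP; apply: (valP x). Qed.

Hypothesis ee : forall x, e (e x) = e x.

Definition fixed_proj (x : M) : fixed := Fixed (introT eqP (ee x) : e x \in fixed_pred).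

Fact fixed_proj_linear : linear fixed_proj.
Proof. by move=> a x y; apply: val_inj; rewrite /= linearP. Qed.

HB.instance Definition _ := GRing.isLinear.Build R M fixed *:%R fixed_proj
  fixed_proj_linear.

End Fixed.

Section Retracts.

Variable B : nzRingType.
Implicit Types X Y Z : complex B.

(** The splitting is strict in each degree, not up to homotopy. *)
Definition retract X Y : Prop :=
  exists (f : chain_map X Y) (g : chain_map Y X), forall i, cancel (f i) (g i).

Section Comp.

Variables (X Y Z : complex B) (g : chain_map Y Z) (f : chain_map X Y).

Fact comp_chainE i j x :
  (g j \o f j) (cdiff X i j x) = cdiff Z i j ((g i \o f i) x).
Proof. by rewrite /= !cmapE. Qed.

Definition comp_chain : chain_map X Z :=
  @ChainMap B X Z (fun i => (g i \o f i : {linear _ -> _})) comp_chainE.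

End Comp.

Definition id_chain X : chain_map X X :=
  @ChainMap B X X (fun i => (idfun : {linear X i -> X i})) (fun _ _ _ => erefl).

Lemma retract_refl X : retract X X.
Proof. by exists (id_chain X), (id_chain X). Qed.

Lemma retract_trans Y X Z : retract X Y -> retract Y Z -> retract X Z.
Proof.
move=> [f [g fK]] [f' [g' f'K]].
by exists (comp_chain f' f), (comp_chain g g') => i x /=; rewrite f'K fK.
Qed.

Lemma iso_retract X Y : iso X Y -> retract X Y.
Proof. by case=> f [g fK]; exists f, g => i; case: (fK i). Qed.

Lemma iso_sym X Y : iso X Y -> iso Y X.
Proof. by case=> f [g fK]; exists g, f => i; case: (fK i). Qed.

Lemma retract_zero X Y : retract X Y -> is_zero Y -> is_zero X.
Proof. by move=> [f [g fK]] Y0 i x; rewrite -(fK i x) (Y0 i (f i x)) linear0. Qed.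

Section Dsum.

Variables X Y : complex B.

Definition inl_fun i (x : X i) : dsum X Y i := (x, 0).

Fact inl_fun_linear i : linear (@inl_fun i).
Proof.
by move=> a x y; apply: injective_projections; rewrite /= ?scaler0 ?addr0.
Qed.

HB.instance Definition _ i :=
  GRing.isLinear.Build B (X i) (dsum X Y i) *:%R (@inl_fun i) (@inl_fun_linear i).

Fact inl_funE i j x : inl_fun (cdiff X i j x) = cdiff (dsum X Y) i j (inl_fun x).
Proof. by rewrite /= /dsum_diff /= linear0. Qed.

Definition dsum_inl : chain_map X (dsum X Y) :=
  @ChainMap B X (dsum X Y) (fun i => (@inl_fun i : {linear _ -> _})) inl_funE.

Definition inr_fun i (x : Y i) : dsum X Y i := (0, x).

Fact inr_fun_linear i : linear (@inr_fun i).
Proof.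
by move=> a x y; apply: injective_projections; rewrite /= ?scaler0 ?addr0.
Qed.

HB.instance Definition _ i :=
  GRing.isLinear.Build B (Y i) (dsum X Y i) *:%R (@inr_fun i) (@inr_fun_linear i).

Fact inr_funE i j x : inr_fun (cdiff Y i j x) = cdiff (dsum X Y) i j (inr_fun x).
Proof. by rewrite /= /dsum_diff /= linear0. Qed.

Definition dsum_inr : chain_map Y (dsum X Y) :=
  @ChainMap B Y (dsum X Y) (fun i => (@inr_fun i : {linear _ -> _})) inr_funE.

Definition dsum_fst : chain_map (dsum X Y) X :=
  @ChainMap B (dsum X Y) X (fun i => (fst : {linear (X i * Y i)%type -> X i}))
    (fun _ _ _ => erefl).

Definition dsum_snd : chain_map (dsum X Y) Y :=
  @ChainMap B (dsum X Y) Y (fun i => (snd : {linear (X i * Y i)%type -> Y i}))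
    (fun _ _ _ => erefl).

Lemma dsum_split i (u : dsum X Y i) :
  u = dsum_inl i (dsum_fst i u) + dsum_inr i (dsum_snd i u).
Proof.
by case: u => x y; apply: (@injective_projections (X i) (Y i)); rewrite /= ?addr0 ?add0r.
Qed.

Lemma retract_dsuml : retract X (dsum X Y).
Proof. by exists dsum_inl, dsum_fst. Qed.

Lemma retract_dsumr : retract Y (dsum X Y).
Proof. by exists dsum_inr, dsum_snd. Qed.

End Dsum.

Section Split.

Variables (X : complex B) (e : chain_map X X).
Hypothesis ee : forall i x, e i (e i x) = e i x.

Definition split_obj i : lmodType B := fixed (e i).

Definition split_diff i j : {linear split_obj i -> split_obj j} :=
  (@fixed_proj _ _ (e j) (@ee j) \o (cdiff X i j \o (val : {linear fixed (e i) -> X i}))).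

Lemma split_diffE i j x : val (split_diff i j x) = cdiff X i j (val x).
Proof. by rewrite /= cmapE fixed_valE. Qed.

Fact split_diff_shape i j : j != i + 1 -> forall x, split_diff i j x = 0.
Proof. by move=> ij x; apply: val_inj; rewrite split_diffE cdiff_shape. Qed.

Fact split_diffK i j l x : split_diff j l (split_diff i j x) = 0.
Proof. by apply: val_inj; rewrite !split_diffE cdiffK. Qed.

Definition split_complex : complex B := Complex split_diff_shape split_diffK.

Definition split_val : chain_map split_complex X :=
  @ChainMap B split_complex X (fun i => (val : {linear fixed (e i) -> X i})) split_diffE.

Fact split_projE i j x :
  fixed_proj (@ee j) (cdiff X i j x) = split_diff i j (fixed_proj (@ee i) x).
Proof. by apply: val_inj; rewrite split_diffE /= cmapE. Qed.

Definition split_proj : chain_map X split_complex :=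
  @ChainMap B X split_complex
    (fun i => (@fixed_proj _ _ (e i) (@ee i) : {linear _ -> _})) split_projE.

Lemma split_valK i : cancel (split_val i) (split_proj i).
Proof. by move=> x; apply: val_inj; rewrite /= fixed_valE. Qed.

Lemma split_projK i x : split_val i (split_proj i x) = e i x.
Proof. by []. Qed.

Lemma retract_split : retract split_complex X.
Proof. by exists split_val, split_proj; apply: split_valK. Qed.

End Split.

Section Compl.

Variables (X : complex B) (e : chain_map X X).

Fact compl_chainE i j x :
  (idfun \- e j) (cdiff X i j x) = cdiff X i j ((idfun \- e i) x).
Proof. by rewrite /= linearB cmapE. Qed.

Definition compl_chain : chain_map X X :=
  @ChainMap B X X (fun i => ((idfun : {linear X i -> X i}) \- e i : {linear _ -> _}))
    compl_chainE.

End Compl.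

Lemma iso_split X (e : chain_map X X) (ee : forall i x, e i (e i x) = e i x)
    (ee' : forall i x, compl_chain e i (compl_chain e i x) = compl_chain e i x) :
  iso X (dsum (split_complex ee) (split_complex ee')).
Proof.
pose D := dsum (split_complex ee) (split_complex ee').
pose f i (x : X i) : D i :=
  (split_proj ee i x, split_proj ee' i x).
have fl i : linear (@f i) by move=> a x y; rewrite /f !linearP.
pose f' i : {linear X i -> D i} :=
  HB.pack (@f i) (GRing.isLinear.Build B (X i) (D i) *:%R (@f i) (fl i)).
pose g i (u : D i) : X i :=
  split_val ee i u.1 + split_val ee' i u.2.
have gl i : linear (@g i).
  by move=> a u v; rewrite /g !linearP addrACA -scalerDr.
pose g' i : {linear D i -> X i} :=
  HB.pack (@g i) (GRing.isLinear.Build B (D i) (X i) *:%R (@g i) (gl i)).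
have fE i j x : f' j (cdiff X i j x) = cdiff D i j (f' i x).
  apply: injective_projections; first exact: (cmapE (split_proj ee)).
  exact: (cmapE (split_proj ee')).
have gE i j x : g' j (cdiff D i j x) = cdiff X i j (g' i x).
  rewrite -[LHS]/(split_val ee j _ + split_val ee' j _) !cmapE.
  by rewrite [RHS]/= [in RHS]/g linearD.
have fgK i : cancel (f' i) (g' i).
  by move=> x; rewrite -[LHS]/(e i x + (x - e i x)) addrC subrK.
exists (ChainMap fE), (ChainMap gE) => i; split; first exact: fgK.
move=> [u v]; rewrite /= /f /g /=.
have eu : e i (val u) = val u := fixed_valE u.
have ev : e i (val v) = 0.
  by apply/eqP; have /eqP := fixed_valE v; rewrite /= -subr_eq0 addrC addKr oppr_eq0.
congr (_, _); apply: val_inj => /=.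
  by rewrite linearD eu ev addr0.
by rewrite linearD eu ev addr0 addrC addKr.
Qed.

Lemma retract_fin_generated (M N : lmodType B) (f : {linear M -> N}) (g : {linear N -> M}) :
  cancel f g -> fin_generated N -> fin_generated M.
Proof.
move=> fK [n [e spane]]; exists n, (g \o e) => x.
have [c xc] := spane (f x); exists c; rewrite -[LHS]fK xc linear_sum.
by apply: eq_bigr => s _; rewrite linearZ.
Qed.

Lemma retract_projective (P Q : lmodType B) (f : {linear P -> Q}) (g : {linear Q -> P}) :
  cancel f g -> projective Q -> projective P.
Proof.
move=> fK projQ M N u v u_surj.
have [h hE] := projQ M N u (v \o g : {linear _ -> _}) u_surj.
by exists (h \o f : {linear _ -> _}) => x; rewrite /= hE /= fK.
Qed.

Lemma retract_in_Cm m X Y : retract X Y -> in_Cm m Y -> in_Cm m X.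
Proof.
move=> [f [g fK]] [[projY bndY] minY vanY].
have van i : (forall y : Y i, y = 0) -> forall x : X i, x = 0.
  by move=> Y0 x; rewrite -(fK i x) (Y0 (f i x)) linear0.
split; last by move=> i /vanY /van.
  split; last by case: bndY => a [b bndY]; exists a, b => i /bndY /van.
  move=> i; case: (projY i) => fgY prY.
  by split; [apply: retract_fin_generated (fK i) fgY | apply: retract_projective (fK i) prY].
(* Since d x = g (f (d x)) = g (d (f x)), the value is the image under g of a radical element. *)
move=> i x; rewrite -[cdiff _ _ _ _]fK; apply: in_rad_map.
by rewrite cmapE.
Qed.

End Retracts.

(** * Fitting's lemma for indecomposable complexes *)

Section Locality.

Variables (F : fieldType) (B : falgType F).
Implicit Types X Y Z : complex B.

Section PolyChain.

Variables (X : complex B) (f : chain_map X X).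

Fact poly_chainE p i j x :
  poly_endo (f j) p (cdiff X i j x) = cdiff X i j (poly_endo (f i) p x).
Proof.
rewrite /poly_endo linear_sum; apply: eq_bigr => s _; rewrite linearZ; congr (_ *: _).
by elim: (nat_of_ord s) => //= n ->; rewrite cmapE.
Qed.

Definition poly_chain p : chain_map X X :=
  @ChainMap B X X (fun i => (poly_endo (f i) p : {linear _ -> _})) (poly_chainE p).

(** Multiply the annihilating polynomials of the degrees 0, ..., m; in all other degrees [X] is
    zero. *)
Lemma poly_chain_annihilated m : in_Cm m X ->
  exists2 q, q != 0 & forall i x, poly_chain q i x = 0.
Proof.
case=> -[projX _] _ vanX.
have /fin_all_exists2[q qn0 q0] (s : 'I_m.+1) :
    exists2 q, q != 0 & forall x, poly_endo (f (s : nat)%:Z) q x = 0.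
  by apply: poly_endo_annihilated; case: (projX (s : nat)%:Z).
exists (\prod_s q s) => [|i x]; first by apply/prodf_neq0.
have [im|/vanX x0] := boolP (0 <= i <= m%:Z); last exact: x0.
have [n Ei] : exists n : nat, i = n%:Z by exists `|i|%N; case: i im {x}.
move: x im; rewrite Ei => x; rewrite lez_nat => le_nm.
have lt_nm : (n < m.+1)%N by [].
by rewrite (bigD1 (Ordinal lt_nm)) //= mulrC poly_endoM (q0 (Ordinal lt_nm)) linear0.
Qed.

(** If u p + v q = 1 and p(f) = 0, then v(f) inverts q(f). *)
Lemma poly_chain_inv p q : (forall i x, poly_chain p i x = 0) -> coprimep p q ->
  exists g : chain_map X X, forall i, cancel (poly_chain q i) (g i).
Proof.
move=> p0 /Bezout_eq1_coprimepP[[u v] /= uv1].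
exists (poly_chain v) => i x; rewrite -[RHS](poly_endo1 (f i)) -uv1.
by rewrite poly_endoD !poly_endoM -/(poly_chain p i x) p0 linear0 add0r.
Qed.

End PolyChain.

Lemma indecomposable_idempotent m X (e : chain_map X X) :
  indecomposable_in_Cm m X -> (forall i x, e i (e i x) = e i x) ->
  (forall i x, e i x = 0) \/ (forall i x, e i x = x).
Proof.
move=> [CmX _ indX] ee.
have ee' i x : compl_chain e i (compl_chain e i x) = compl_chain e i x.
  by rewrite /= linearB ee subrr subr0.
case: (indX _ _ _ _ (iso_split ee ee')) => [||Z0|Z0].
- exact: retract_in_Cm (retract_split ee) CmX.
- exact: retract_in_Cm (retract_split ee') CmX.
- by left=> i x; rewrite -(split_projK ee) (Z0 i (split_proj ee i x)) linear0.
right=> i x; apply/esym/eqP; rewrite -subr_eq0.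
by rewrite -[_ - _]/(compl_chain e i x) -(split_projK ee') (Z0 i (split_proj ee' i x)) linear0.
Qed.

(* Fitting's lemma: writing the annihilating polynomial as X^n * r with r(0) <> 0,
   Bezout yields an idempotent which is 0 (then f is nilpotent) or 1 (then f is
   invertible). *)
Lemma indecomposable_local m X (f : chain_map X X) : indecomposable_in_Cm m X ->
  exists g : chain_map X X,
    (forall i, cancel (f i) (g i)) \/ (forall i, cancel (compl_chain f i) (g i)).
Proof.
move=> indX; case: (indX) => CmX _ _.
have [q qn0 q0] := poly_chain_annihilated f CmX.
have [n [r]] := multiplicity_XsubC q 0; rewrite qn0 subr0 /= => r0 qE.
have copXr : coprimep ('X ^+ n) r.
  by apply: coprimep_expl; rewrite coprimep_sym coprimepX.
have /Bezout_eq1_coprimepP[[u v] /= uv1] := copXr.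
have rX0 i x : poly_endo (f i) (r * 'X ^+ n) x = 0 by rewrite -qE; apply: q0.
have e1E i x : poly_endo (f i) (u * 'X^n) x + poly_endo (f i) (v * r) x = x.
  by rewrite -poly_endoD uv1 poly_endo1.
case: (@indecomposable_idempotent m X (poly_chain f (u * 'X ^+ n)) indX) => [i x|e0|e1].
- have z : poly_endo (f i) (u * 'X ^+ n) (poly_endo (f i) (v * r) x) = 0.
    rewrite -poly_endoM (_ : _ * _ = u * v * (r * 'X^n)); last by ring.
    by rewrite poly_endoM rX0 linear0.
  by rewrite /= -[in RHS](e1E i x) linearD /= z addr0.
(* If the idempotent is 0, every x equals (v r)(f) x, so f^n = 0. As X^n and 1 - X are coprime, 1 -
   f has a left inverse. *)
- have X0 i x : poly_chain f 'X^n i x = 0.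
    rewrite /= -(e1E i x) linearD -[poly_endo _ (u * _) _]/(poly_chain _ _ _ _) e0.
    rewrite linear0 add0r /= -poly_endoM.
    by rewrite mulrC -mulrA poly_endoM rX0 linear0.
  have cop : coprimep ('X ^+ n) (1 - 'X : {poly F}).
    apply: coprimep_expl; rewrite coprimep_sym coprimepX.
    by rewrite /root !hornerE subr0 oner_eq0.
  have [g gK] := poly_chain_inv X0 cop; exists g; right=> i x.
  rewrite -[RHS](gK i x); congr (g i _); apply/eqP; rewrite /= subr_eq.
  by rewrite -(poly_endoX (f i) x) -poly_endoD subrK poly_endo1.
(* If the idempotent is 1, every x equals (u X^n)(f) x, so r(f) = 0. As r(0) is nonzero, r is
   coprime to X and f has a left inverse. *)
have r0' i x : poly_chain f r i x = 0.
  by rewrite -[x](e1 i) /= -poly_endoM mulrCA poly_endoM rX0 linear0.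
have cop : coprimep r 'X by rewrite coprimepX.
have [g gK] := poly_chain_inv r0' cop; exists g; left=> i x.
by rewrite -[RHS](gK i x) /= poly_endoX.
Qed.

End Locality.

(** * The Krull-Schmidt property and cohomological invariants *)

Section KrullSchmidt.

Variables (F : fieldType) (B : falgType F) (m : nat).
Implicit Types X Y Z : complex B.

(** The paths through [Z] and [Z'] give two endomorphisms of [Y] with sum 1. By locality one of them
    has a left inverse, which corrects the projection onto [Y]. *)
Lemma indecomposable_retract_dsum Y Z Z' : indecomposable_in_Cm m Y ->
  retract Y (dsum Z Z') -> retract Y Z \/ retract Y Z'.
Proof.
move=> indY [f [g fK]].
pose fl := comp_chain (dsum_fst Z Z') f; pose fr := comp_chain (dsum_snd Z Z') f.
pose gl := comp_chain g (dsum_inl Z Z'); pose gr := comp_chain g (dsum_inr Z Z').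
have [h [hK|hK]] := indecomposable_local (comp_chain gl fl) indY.
  by left; exists fl, (comp_chain h gl) => i x; apply: hK.
right; exists fr, (comp_chain h gr) => i x; rewrite -[RHS](hK i x) /=.
congr (h i _); apply/eqP; rewrite eq_sym subr_eq -linearD addrC.
by rewrite -[X in _ == g i X](dsum_split (f i x)) fK.
Qed.

(** The composite f g is an idempotent endomorphism of [Z], hence 0 or 1; the value 0 would force
    [Y] to vanish. *)
Lemma indecomposable_retract_iso Y Z : indecomposable_in_Cm m Y ->
  indecomposable_in_Cm m Z -> retract Y Z -> iso Y Z.
Proof.
move=> [_ nY0 _] indZ [f [g fK]].
have [i x|e0|e1] := @indecomposable_idempotent _ _ _ _ (comp_chain f g) indZ.
- by rewrite /= fK.
- case: nY0 => i y; rewrite -(fK i y) -(fK i (g i (f i y))).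
  by rewrite -[f i (g i _)]/(comp_chain f g i _) e0 linear0.
by exists f, g => i; split; [apply: fK | apply: e1].
Qed.

Definition has_dim (M : lmodType B) n : Prop :=
  exists2 e : 'I_n -> fmod M, indep_mod (fun x => x = 0) e
                            & forall x, spans_mod (fun x => x = 0) e x.

Lemma has_dim_exists (M : lmodType B) : fin_generated M -> exists n, has_dim M n.
Proof.
move=> /fin_generated_span[d [g spang]].
have [|n [e [_ ie se]]] := @basis_exists _ (fmod M) _ (submodule_eq0 _) (fun=> True) d.
  move=> n e _ ie; apply: (indep_leq_span (submodule_eq0 _) ie (g := g)) => s.
  by have [c ec] := spang (e s); exists c; rewrite {1}ec subrr.
by exists n, e => // x; apply: se.
Qed.

Lemma has_dim_add (M N P : lmodType B) (f : {linear M -> P}) (g : {linear N -> P}) a b c :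
  (forall x y, f x + g y = 0 -> x = 0 /\ y = 0) ->
  has_dim M a -> has_dim N b -> has_dim P c -> (a + b <= c)%N.
Proof.
move=> fg0 [e ie _] [e' ie' _] [h _ sh].
pose e2 (s : 'I_(a + b)) : fmod P :=
  match split s with inl t => f (e t) | inr t => g (e' t) end.
have e2l t : e2 (lshift b t) = f (e t) by rewrite /e2 (unsplitK (inl t)).
have e2r t : e2 (rshift a t) = g (e' t) by rewrite /e2 (unsplitK (inr t)).
apply: (indep_leq_span (submodule_eq0 _) (e := e2) _ (fun s => sh _)) => k.
rewrite big_split_ord /=.
under eq_bigr => t _ do rewrite e2l.
under [X in _ + X]eq_bigr => t _ do rewrite e2r.
rewrite -!linear_comb => /fg0[/ie kl /ie' kr] s.
by case: (splitP s) => t st;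
  [rewrite (_ : s = lshift b t) ?kl | rewrite (_ : s = rshift a t) ?kr] => //; apply: val_inj.
Qed.

Lemma has_dim_gt0 (M : lmodType B) n (x : M) : has_dim M n -> x <> 0 -> (0 < n)%N.
Proof.
case: n => // -[e _ se] x0; case: x0; have [c /eqP] := se x.
by rewrite big_ord0 subr0 => /eqP.
Qed.

Definition has_total_dim X d : Prop :=
  exists2 n : 'I_m.+1 -> nat, forall s : 'I_m.+1, has_dim (X (s : nat)%:Z) (n s)
                            & d = (\sum_s n s)%N.

Lemma has_total_dim_exists X : in_Cm m X -> exists d, has_total_dim X d.
Proof.
move=> [[fgX _] _ _].
have /fin_all_exists[n dimn] (s : 'I_m.+1) : exists n, has_dim (X (s : nat)%:Z) n.
  by apply: has_dim_exists; case: (fgX (s : nat)%:Z).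
by exists (\sum_s n s)%N, n.
Qed.

Lemma has_total_dim_add X Y Z a b d : iso X (dsum Y Z) ->
  has_total_dim X d -> has_total_dim Y a -> has_total_dim Z b -> (a + b <= d)%N.
Proof.
move=> [f0 [f fK]] [nX dX ->] [nY dY ->] [nZ dZ ->].
rewrite -big_split; apply: leq_sum => s _.
apply: (has_dim_add _ (dY s) (dZ s) (dX s)
  (f := comp_chain f (dsum_inl Y Z) _) (g := comp_chain f (dsum_inr Y Z) _)).
move=> y z; rewrite /= -linearD => fyz0.
have := proj2 (fK (s : nat)%:Z) (inl_fun Z y + inr_fun Y z).
rewrite fyz0 linear0 => yz0; move: (congr1 fst yz0) (congr1 snd yz0).
by rewrite /= addr0 add0r => <- <-.
Qed.

(* Induction on the total dimension: every object of C_m is a finite direct sum of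
   indecomposable ones. *)
Lemma Cm_ind (P : complex B -> Prop) :
  (forall X, is_zero X -> P X) ->
  (forall X, indecomposable_in_Cm m X -> P X) ->
  (forall X Y Z, iso X (dsum Y Z) -> P Y -> P Z -> P X) ->
  forall X, in_Cm m X -> P X.
Proof.
move=> P0 Pind Psum X CmX; have [d] := has_total_dim_exists CmX.
elim/ltn_ind: d X CmX => d IHd X CmX dimX.
have [/P0//|nX0] := pselect (is_zero X).
have [/Pind//|nindX] := pselect (indecomposable_in_Cm m X).
have [Y [Z [CmY CmZ isoX nY0 nZ0]]] : exists Y Z,
    [/\ in_Cm m Y, in_Cm m Z, iso X (dsum Y Z), ~ is_zero Y & ~ is_zero Z].
  apply: contrapT => nex; apply: nindX; split=> // Y Z CmY CmZ isoX.
  have [|nY0] := pselect (is_zero Y); first by left.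
  have [|nZ0] := pselect (is_zero Z); first by right.
  by case: nex; exists Y, Z.
have [a dimY] := has_total_dim_exists CmY; have [b dimZ] := has_total_dim_exists CmZ.
have le_abd := has_total_dim_add isoX dimX dimY dimZ.
(* Nonzero complexes have positive total dimension, so both summands are strictly smaller than
   [X]. *)
have dim_gt0 W c : in_Cm m W -> ~ is_zero W -> has_total_dim W c -> (0 < c)%N.
  move=> [_ _ vanW] nW0 [n dimW ->]; rewrite lt0n; apply/negP => /eqP sum0.
  apply: nW0 => i w; have [im|/vanW w0] := boolP (0 <= i <= m%:Z); last exact: w0.
  have [j Ei] : exists j : nat, i = j%:Z by exists `|i|%N; case: i im {w}.
  move: w im; rewrite Ei => w; rewrite lez_nat => le_jm; apply: contrapT => w0.
  have lt_jm : (j < m.+1)%N by [].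
  have := has_dim_gt0 (dimW (Ordinal lt_jm)) w0.
  by move/eqP: sum0; rewrite sum_nat_eq0 => /forallP/(_ (Ordinal lt_jm))/eqP->.
have a0 := dim_gt0 _ _ CmY nY0 dimY; have b0 := dim_gt0 _ _ CmZ nZ0 dimZ.
apply: (Psum _ _ _ isoX).
  by apply: (IHd a) => //; apply: leq_trans le_abd; rewrite -addn1 leq_add2l.
by apply: (IHd b) => //; apply: leq_trans le_abd; rewrite -add1n leq_add2r.
Qed.

End KrullSchmidt.

(** * Finiteness up to isomorphism *)

Section FinitelyMany.

Variable B : nzRingType.
Implicit Types P Q : complex B -> Prop.

Lemma finitely_manyT (T : finType) P (L : T -> complex B) :
  (forall X, P X -> exists t, iso X (L t)) -> finitely_many_up_to_iso P.
Proof.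
move=> PL; exists #|T|, (fun s => L (enum_val s)) => X /PL[t isoX].
by exists (enum_rank t); rewrite enum_rankK.
Qed.

Lemma sub_finitely_many P Q : (forall X, P X -> Q X) ->
  finitely_many_up_to_iso Q -> finitely_many_up_to_iso P.
Proof. by move=> PQ [n [L QL]]; exists n, L => X /PQ/QL. Qed.

Lemma finitely_many_none P : (forall X, ~ P X) -> finitely_many_up_to_iso P.
Proof. by move=> P0; apply: (@finitely_manyT void _ (of_void _)) => X /P0. Qed.

Lemma finitely_many_bigcup (T : finType) (P : T -> complex B -> Prop) :
  (forall t, finitely_many_up_to_iso (P t)) ->
  finitely_many_up_to_iso (fun X => exists t, P t X).
Proof.
move=> finP.
have /choice[L PL] (t : T) : exists L : {n & 'I_n -> complex B},
    forall X, P t X -> exists i, iso X (projT2 L i).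
  by have [n [L PL]] := finP t; exists (existT _ n L).
pose S : finType := {t : T & 'I_(projT1 (L t))}.
apply: (@finitely_manyT S _ (fun s => projT2 (L (tag s)) (tagged s))) => X [t /PL[i isoX]].
by exists (Tagged (fun t => 'I_(projT1 (L t))) i).
Qed.

End FinitelyMany.

(** By induction along a decomposition of [X], an indecomposable retract of [X] is a retract of an
    indecomposable summand, hence isomorphic to it. *)
Lemma finitely_many_retracts (F : fieldType) (B : falgType F) m (X : complex B) :
  in_Cm m X ->
  finitely_many_up_to_iso (fun Y => indecomposable_in_Cm m Y /\ retract Y X).
Proof.
elim/Cm_ind : X / => [X X0|X indX|X Y Z isoX finY finZ].
- apply: finitely_many_none => Y [[_ nY0 _]] /retract_zero/(_ X0).
  exact: nY0.
- exists 1%N, (fun=> X) => Y [indY retY]; exists ord0.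
  exact: indecomposable_retract_iso indY indX retY.
pose P (b : bool) W := indecomposable_in_Cm m W /\ retract W (if b then Y else Z).
apply: (@sub_finitely_many _ _ (fun W => exists b, P b W)); last first.
  by apply: finitely_many_bigcup => -[].
move=> W [indW retW].
have := indecomposable_retract_dsum indW (retract_trans retW (iso_retract isoX)).
by case=> ?; [exists true | exists false].
Qed.

(** * Dimensions of cohomology *)

Section Cohomology.

Variables (F : fieldType) (B : falgType F).
Implicit Types X Y : complex B.

Fact coboundary_submodule X i : submodule (@coboundary B X i).
Proof.
split=> [|a _ _ [x <-] [y <-]]; first by exists 0; rewrite linear0.
by exists (a *: x + y); rewrite linearP.
Qed.

(** This is the bound dim H^i(X) <= N. Spanning families, unlike bases, pass directly to retracts
    and through the functors. *)
Definition coh_span X i N : Prop :=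
  exists2 e : 'I_N -> fmod (X i), forall s, cocycle (e s)
  & forall x : X i, cocycle x -> spans_mod (V := fmod (X i)) (@coboundary B X i) e x.

Lemma coh_dim_span X i n : coh_dim X i n -> coh_span X i n.
Proof. by case=> e ze se; exists e => // x /se[c [Dc _]]; exists c. Qed.

Let sD X i := submodule_fmod (@coboundary_submodule X i).

Lemma coh_dim_leq X i n N : coh_dim X i n -> coh_span X i N -> (n <= N)%N.
Proof.
case=> e ze se [g zg sg].
apply: (indep_leq_span (sD X i) (e := e : 'I_n -> fmod (X i)) _ (fun s => sg _ (ze s))).
move=> c Dc s.
(* Both [c] and the zero family represent the class of 0, so the uniqueness in [coh_dim] gives c =
   0: the basis is independent modulo coboundaries. *)
have z0 : cocycle (0 : X i) by rewrite /cocycle linear0.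
have [c0 [_ uc0]] := se 0 z0.
have c0E (c' : {ffun 'I_n -> F}) : coboundary (0 - \sum_s ((c' s)%:A : B) *: e s) -> c0 = c'.
  exact: uc0.
have /c0E c01 : coboundary (0 - \sum_s (([ffun=> 0] : {ffun 'I_n -> F}) s)%:A *: e s).
  rewrite big1 ?subr0 => [|t _]; last by rewrite ffunE scale0r scale0r.
  exact: submod0 (coboundary_submodule X i).
have /c0E : coboundary (0 - \sum_s ((finfun c : {ffun 'I_n -> F}) s)%:A *: e s).
  rewrite sub0r; apply: (submodN (coboundary_submodule X i)).
  by under eq_bigr => t _ do rewrite ffunE.
by rewrite c01 => /ffunP/(_ s); rewrite !ffunE.
Qed.

Lemma coh_dim_exists X i : fin_generated (X i) -> exists n, coh_dim X i n.
Proof.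
move=> /fin_generated_span[d [g spang]].
have [|n [e [ze ie se]]] :=
    @basis_exists _ (fmod (X i)) (@coboundary B X i) (sD X i) (@cocycle B X i) d.
  move=> n e _ ie; apply: (indep_leq_span (sD X i) ie (g := g)) => s.
  have [c ec] := spang (e s); exists c; rewrite {1}ec subrr.
  exact: submod0 (coboundary_submodule X i).
exists n, e => // x /se[c Dc]; exists (finfun c); split.
  by under eq_bigr => t _ do rewrite ffunE.
move=> c' Dc'; apply/ffunP => s; rewrite ffunE; apply/eqP; rewrite -subr_eq0.
apply/eqP; apply: (ie (fun s => c s - c' s)).
have := submodB (sD X i) Dc' Dc; rewrite opprB addrC addrA subrK.
under [X in _ -> coboundary X]eq_bigr => t _ do rewrite scalerBl.
by rewrite sumrB.
Qed.

Lemma coh_span_retract X Y i N : retract X Y -> coh_span Y i N -> coh_span X i N.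
Proof.
move=> [f [g fK]] [e ze se]; exists (fun s => g i (e s)) => [s|x zx].
  by rewrite /cocycle -cmapE ze linear0.
have [|c [y dy]] := se (f i x); first by rewrite /cocycle -cmapE zx linear0.
exists c; exists (g (i - 1) y); rewrite -cmapE dy linearB fK.
by rewrite -linear_comb.
Qed.

Lemma coh_span0 X i : coh_span X i 0 <-> ~ coh_neq0 X i.
Proof.
split=> [[e _ se] [x /se[c]]|coh0]; first by rewrite big_ord0 subr0.
exists (fun=> 0) => [[]|x zx] //; exists (fun=> 0); rewrite big_ord0 subr0.
by apply: contrapT => nDx; apply: coh0; exists x.
Qed.

End Cohomology.

(** This collects what extension and restriction have in common, so that both directions of each
    equivalence are instances of one argument. The factor [c] will be [K : k]. *)
Record Cm_functor (F F' : fieldType) (B : falgType F) (B' : falgType F') (m c : nat)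
    (E : complex B -> complex B') : Prop := {
  functor_retract : forall X Y, retract X Y -> retract (E X) (E Y);
  functor_dsum : forall X Y, retract (E (dsum X Y)) (dsum (E X) (E Y));
  functor_zero : forall X, is_zero X -> is_zero (E X);
  functor_Cm : forall X, in_Cm m X -> in_Cm m (E X);
  functor_coh : forall X i N, coh_span X i N -> coh_span (E X) i (c * N)
}.

(** Case N = 0 of [functor_coh]: vanishing of H^i passes from [X] to [E X] and to its retracts. *)
Lemma functor_coh_neq0 (F F' : fieldType) (B : falgType F) (B' : falgType F') m c
    (E : complex B -> complex B') X Z i : Cm_functor m c E ->
  retract Z (E X) -> coh_neq0 Z i -> coh_neq0 X i.
Proof.
move=> funE retZ cohZ; apply: contrapT => /coh_span0 /(functor_coh funE).
by rewrite muln0 => /(coh_span_retract retZ)/coh_span0.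
Qed.

(** Induction along a decomposition of [X]: the image of a direct sum is a retract of the sum of the
    images, and the indecomposable [W] is a retract of one of them. *)
Lemma functor_indecomposable (F F' : fieldType) (B : falgType F) (B' : falgType F')
    m c (E : complex B -> complex B') X W : Cm_functor m c E ->
  in_Cm m X -> indecomposable_in_Cm m W -> retract W (E X) ->
  exists X', [/\ indecomposable_in_Cm m X', retract X' X & retract W (E X')].
Proof.
move=> funE CmX indW; elim/Cm_ind : X / CmX => [X X0|X indX retW|X Y Z isoX IHY IHZ].
- by move=> /retract_zero/(_ (functor_zero funE X0)); case: indW.
- by exists X; split=> //; apply: retract_refl.
move=> /retract_trans/(_ (functor_retract funE (iso_retract isoX))).
move=> /retract_trans/(_ (functor_dsum funE _ _))/(indecomposable_retract_dsum indW).
case=> [/IHY|/IHZ] [X' [indX' retX' retW]]; exists X'; split=> //;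
  apply: (retract_trans _ (iso_retract (iso_sym isoX))); apply: (retract_trans retX').
  exact: retract_dsuml.
exact: retract_dsumr.
Qed.

Lemma increasing_sequence_exists (P : nat -> Prop) : (forall n, exists2 p, (n < p)%N & P p) ->
  exists2 r : nat -> nat, forall i, (r i < r i.+1)%N & forall i, P (r i).
Proof.
move=> exP; have /choice[next nextP] n : exists p, (n < p)%N /\ P p.
  by have [p] := exP n; exists p.
exists (fun i => iter i.+1 next 0%N) => i /=; first by case: (nextP (next (iter i next 0%N))).
by case: (nextP (iter i next 0%N)).
Qed.

(** * Transfer of representation types *)

Section Transfer.

Variables (F F' : fieldType) (B : falgType F) (B' : falgType F') (m c : nat).
Variables (E : complex B -> complex B') (R : complex B' -> complex B).
Hypotheses (funE : Cm_functor m c E) (funR : Cm_functor m c R).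
Hypothesis retractER : forall Y, retract Y (E (R Y)).

Lemma finite_rep_type_transfer : finite_rep_type B m -> finite_rep_type B' m.
Proof.
move=> [n [L indL]].
(* [finite_rep_type] puts no condition on [L t]; recording that [E (L t)] lies in C_m makes the
   class of [t] empty where [finitely_many_retracts] does not apply. *)
pose P t Y := [/\ in_Cm m (E (L t)), indecomposable_in_Cm m Y & retract Y (E (L t))].
apply: (@sub_finitely_many _ _ (fun Y => exists t : 'I_n, P t Y)); last first.
  apply: finitely_many_bigcup => t.
  have [CmL|nCmL] := pselect (in_Cm m (E (L t))).
    by apply: sub_finitely_many (finitely_many_retracts CmL) => Y [].
  by apply: finitely_many_none => Y [].
move=> Y indY; case: (indY) => CmY _ _.
have [X [indX _ retY]] :=
  functor_indecomposable funE (functor_Cm funR CmY) indY (retractER Y).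
have [t isoX] := indL X indX; exists t; split=> //.
  apply: functor_Cm funE _ _; case: (indX) => CmX _ _.
  exact: retract_in_Cm (iso_retract (iso_sym isoX)) CmX.
exact: retract_trans retY (functor_retract funE (iso_retract isoX)).
Qed.

Hypothesis retractRE : forall X, retract X (R (E X)).

(** [X] and [Z] have cohomology in the same degrees, hence the same width. In each degree either
    dimension is at most [c] times the other, which bounds the maxima both ways. *)
Lemma hr_transfer X Z r : in_Cm m X -> in_Cm m Z ->
  retract Z (E X) -> retract X (R Z) -> hr X r ->
  exists r', [/\ hr Z r', (r <= c * r')%N & (r' <= c * r)%N].
Proof.
move=> CmX CmZ retZ retX [h [w [[[i0 dimh] maxh] [[i [j [cohi cohj wE]]] maxw] ->]]].
have dimX l : exists d, coh_dim X l d.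
  by apply: coh_dim_exists; case: CmX => -[/(_ l)[]].
have dimZ l : exists d, coh_dim Z l d.
  by apply: coh_dim_exists; case: CmZ => -[/(_ l)[]].
have ZX l : coh_neq0 Z l -> coh_neq0 X l := functor_coh_neq0 funE retZ.
have XZ l : coh_neq0 X l -> coh_neq0 Z l := functor_coh_neq0 funR retX.
pose P n := `[<exists l, coh_dim Z l n>].
have Ple n : P n -> (n <= c * h)%N.
  move=> /asboolP[l dimn]; have [d dimd] := dimX l.
  apply: (leq_trans (coh_dim_leq dimn _)).
    exact: coh_span_retract retZ (functor_coh funE (coh_dim_span dimd)).
  by rewrite leq_mul2l maxh ?orbT //; exists l.
have exP : exists n, P n.
  by have [d dimd] := dimZ 0; exists d; apply/asboolP; exists 0.
case: (ex_maxnP exP Ple) => h' Ph' maxh'; move: (Ph') => /asboolP dimh'.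
exists (h' * w)%N; split; last 1 first.
- by rewrite mulnA leq_mul2r Ple ?orbT.
- exists h', w; split=> //.
    by split=> // p dimp; apply/maxh'/asboolP.
  split; first by exists i, j; split=> //; apply: XZ.
  by move=> p [i' [j' [/ZX ? /ZX ? pE]]]; apply: maxw; exists i', j'.
rewrite mulnA leq_mul2r; apply/orP; right.
have [d dimd] := dimZ i0.
apply: (leq_trans (coh_dim_leq dimh _)).
  exact: coh_span_retract retX (functor_coh funR (coh_dim_span dimd)).
by rewrite leq_mul2l maxh' ?orbT //; apply/asboolP; exists i0.
Qed.

(** Pigeonhole by contradiction: if every range above n had finitely many classes over [B'], the
    complexes of range q would be retracts of [R Z] for finitely many Z, hence finitely many
    themselves. *)
Lemma strongly_unbounded_transfer : strongly_unbounded B m -> strongly_unbounded B' m.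
Proof.
move=> [r ltr infr].
pose inf r' := ~ finitely_many_up_to_iso
  (fun Y : complex B' => indecomposable_in_Cm m Y /\ hr Y r').
apply: (@increasing_sequence_exists inf) => n.
have ler i : (i <= r i)%N by elim: i => // i IHi; apply: leq_ltn_trans (ltr i).
(* As c n < q, the bound q <= c r' forces n < r'; together with r' <= c q it leaves finitely many
   values of r'. *)
set q := r (c * n).+1.
have cnq : (c * n < q)%N := ler _.
apply: contrapT => nex; apply: (infr (c * n).+1); rewrite -/q.
have fin r' : (n < r')%N -> finitely_many_up_to_iso
    (fun Y : complex B' => indecomposable_in_Cm m Y /\ hr Y r').
  by move=> lt_nr'; apply: contrapT => infr'; apply: nex; exists r'.
have [k [L indL]] : finitely_many_up_to_iso (fun Y : complex B' =>
    exists r' : 'I_(c * q).+1, [/\ (n < r')%N, indecomposable_in_Cm m Y & hr Y r']).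
  apply: finitely_many_bigcup => r'; have [/fin fr|nlt] := boolP (n < r')%N.
    by apply: sub_finitely_many fr => Y [].
  by apply: finitely_many_none => Y [].
pose P (t : 'I_k) X :=
  [/\ in_Cm m (R (L t)), indecomposable_in_Cm m X & retract X (R (L t))].
apply: (@sub_finitely_many _ _ (fun X => exists t, P t X)); last first.
  apply: finitely_many_bigcup => t.
  have [CmL|nCmL] := pselect (in_Cm m (R (L t))).
    by apply: sub_finitely_many (finitely_many_retracts CmL) => X [].
  by apply: finitely_many_none => X [].
move=> X [indX hrX]; case: (indX) => CmX _ _.
have [Z [indZ retZ retX]] :=
  functor_indecomposable funR (functor_Cm funE CmX) indX (retractRE X).
case: (indZ) => CmZ _ _.
have [r' [hrZ le_qr le_rq]] := hr_transfer CmX CmZ retZ retX hrX.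
have [|t isoZ] := indL Z.
  have lt_r : (r' < (c * q).+1)%N by [].
  exists (Ordinal lt_r); split=> //=.
  by have := leq_trans cnq le_qr; rewrite ltn_mul2l => /andP[].
exists t; split=> //.
  by apply: (functor_Cm funR); apply: retract_in_Cm (iso_retract (iso_sym isoZ)) CmZ.
exact: retract_trans retX (functor_retract funR (iso_retract isoZ)).
Qed.

End Transfer.

(** * The separability idempotent *)

Section QuotientModule.

Variables (R : nzRingType) (M : lmodType R) (N : M -> Prop) (sN : submodule N).

(** The proof of [submodule N] is an argument so that the closure instance can be inferred from the
    term. *)
Definition quot_pred (_ : submodule N) : {pred M} := [pred x | `[<N x>]].

Fact quot_pred_zmod_closed : zmod_closed (quot_pred sN).
Proof.
split=> [|x y /asboolP Nx /asboolP Ny]; apply/asboolP; first exact: (submod0 sN).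
exact: (submodB sN).
Qed.

HB.instance Definition _ :=
  GRing.isZmodClosed.Build M (quot_pred sN) quot_pred_zmod_closed.

Definition quot_module : Type := Quotient.quot (quot_pred sN).

HB.instance Definition _ := GRing.Zmodule.on quot_module.

Definition quot_pi (x : M) : quot_module := \pi_(Quotient.quot (quot_pred sN))%qT x.

Lemma quot_piD x y : quot_pi (x + y) = quot_pi x + quot_pi y.
Proof. exact: (raddfD (\pi_(Quotient.quot (quot_pred sN))%qT)). Qed.

Lemma quot_pi_eq x y : quot_pi x = quot_pi y <-> N (x - y).
Proof.
split=> [|Nxy].
  by move/eqP; rewrite -Quotient.idealrBE inE => /asboolP.
by apply/eqP; rewrite -Quotient.idealrBE inE; apply/asboolP.
Qed.

Lemma quot_piK q : quot_pi (repr q) = q.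
Proof. exact: reprK. Qed.

Definition quot_scale a (q : quot_module) : quot_module := quot_pi (a *: repr q).

Lemma quot_piZ a x : quot_pi (a *: x) = quot_scale a (quot_pi x).
Proof.
apply/quot_pi_eq; rewrite -scalerBr; apply: submodZ => //.
by apply/quot_pi_eq; rewrite quot_piK.
Qed.

Fact quot_scaleA a b q : quot_scale a (quot_scale b q) = quot_scale (a * b) q.
Proof. by rewrite -[q]quot_piK -!quot_piZ scalerA. Qed.
Fact quot_scale1 : left_id 1 quot_scale.
Proof. by move=> q; rewrite -[q]quot_piK -!quot_piZ scale1r. Qed.
Fact quot_scaleDr : right_distributive quot_scale +%R.
Proof.
move=> a q q'; rewrite -[q]quot_piK -[q']quot_piK -!(quot_piZ, quot_piD).
by rewrite scalerDr.
Qed.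
Fact quot_scaleDl q : {morph quot_scale^~ q : a b / a + b}.
Proof. by move=> a b; rewrite -[q]quot_piK -!(quot_piZ, quot_piD) scalerDl. Qed.

HB.instance Definition _ := GRing.Zmodule_isLmodule.Build R quot_module
  quot_scaleA quot_scale1 quot_scaleDr quot_scaleDl.

Fact quot_pi_linear : linear quot_pi.
Proof. by move=> a x y; rewrite quot_piD quot_piZ. Qed.

HB.instance Definition _ :=
  GRing.isLinear.Build R M quot_module *:%R quot_pi quot_pi_linear.

Lemma quot_pi_eq0 x : quot_pi x = 0 <-> N x.
Proof. by rewrite -(linear0 quot_pi) quot_pi_eq subr0. Qed.

End QuotientModule.

Section SeparabilityIdempotent.

Variables (k : fieldType) (K : fieldExtType k).

(** Such [phi] are the additive maps out of K \otimes_k K. *)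
Definition balanced (V : zmodType) (phi : K -> K -> V) : Prop :=
  [/\ forall x x' y, phi (x + x') y = phi x y + phi x' y,
      forall x y y', phi x (y + y') = phi x y + phi x y'
    & forall c x y, phi (c *: x) y = phi x (c *: y)].

Lemma balanced_suml (V : zmodType) (phi : K -> K -> V) I (r : seq I) (f : I -> K) y :
  balanced phi -> phi (\sum_(i <- r) f i) y = \sum_(i <- r) phi (f i) y.
Proof.
case=> phiD _ _; apply: (big_morph (phi^~ y)) => [x x'|]; first exact: phiD.
by apply: (addrI (phi 0 y)); rewrite -phiD !addr0.
Qed.

(* \sum_s p s \otimes q s is a separability idempotent of K / k; equalities in
   K \otimes_k K are tested on balanced maps. *)
Definition separability_idempotent n (p q : 'I_n -> K) : Prop :=
  \sum_s p s * q s = 1 /\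
  forall (V : zmodType) (phi : K -> K -> V), balanced phi ->
    forall x, \sum_s phi (x * p s) (q s) = \sum_s phi (p s) (q s * x).

(* With P the minimal polynomial of a primitive element theta and
   P / (X - theta) = \sum_i b_i X^i, the idempotent is
   \sum_i theta^i \otimes b_i / P'(theta). *)
Lemma separability_idempotent_exists : separable 1%VS {:K}%VS ->
  exists n (p q : 'I_n -> K), separability_idempotent p q.
Proof.
move=> sepK; pose t := separable_generator 1%VS {:K}%VS.
have Kt : {:K}%VS = <<1%VS; t>>%VS := eq_adjoin_separable_generator sepK (sub1v _).
have sept : separable_element 1%VS t := separable_generatorP _ _.
pose P := minPoly 1%VS t.
have Pt : root P t := root_minPoly _ _.
have [Q PQ] : exists Q, P = Q * ('X - t%:P) by apply/factor_theorem.
(* The denominator Q(t) equals P'(t), which is nonzero by separability. *)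
have P't : P^`().[t] = Q.[t].
  by rewrite PQ derivM derivXsubC !hornerE subrr mulr0 add0r.
have Qt0 : Q.[t] != 0.
  by rewrite -P't; have := separable_root_der 1%VS t; rewrite sept.
have [c Pc] : exists c : {poly k}, P = map_poly (in_alg K) c.
  exact/polyOver1P/minPolyOver.
have coefP i : P`_i = (c`_i)%:A by rewrite Pc coef_map.
have szP : size P = (size Q).+1.
  rewrite PQ size_Mmonic ?monicXsubC ?size_XsubC ?addn2 //.
  by apply: contraNneq Qt0 => ->; rewrite horner0.
pose p (s : 'I_(size P)) := t ^+ s; pose q (s : 'I_(size P)) := Q`_s / Q.[t].
exists (size P), p, q; split.
  under eq_bigr => s _ do rewrite /p /q mulrA [_ * Q`_s]mulrC.
  rewrite -mulr_suml -(horner_coef_wide t (_ : size Q <= size P)%N) ?divff //.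
  by rewrite szP.
(* The elements commuting with the idempotent are closed under sums and products and contain k and
   t, hence all of K = k(t). *)
pose central x := forall (V : zmodType) (phi : K -> K -> V), balanced phi ->
  \sum_s phi (x * p s) (q s) = \sum_s phi (p s) (q s * x).
have centralD x y : central x -> central y -> central (x + y).
  move=> cx cy V phi bphi; case: (bphi) => pDl pDr _.
  under eq_bigr => s _ do rewrite mulrDl pDl.
  under [RHS]eq_bigr => s _ do rewrite mulrDr pDr.
  by rewrite !big_split cx // cy.
have centralM x y : central x -> central y -> central (x * y).
  move=> cx cy V phi bphi; case: (bphi) => pDl pDr pZ.
  under eq_bigr => s _ do rewrite -mulrA.
  rewrite (cy V (fun u v => phi (x * u) v)); last first.
    by split=> *; rewrite ?mulrDr -?scalerAr.
  rewrite (cx V (fun u v => phi u (v * y))); last first.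
    by split=> *; rewrite ?mulrDl -?scalerAl.
  by under eq_bigr => s _ do rewrite -mulrA.
have centralC a : central a%:A.
  move=> V phi [_ _ pZ]; apply: eq_bigr => s _.
  by rewrite mulr_algl mulr_algr pZ.
have central_t : central t.
  move=> V phi bphi; case: (bphi) => pDl pDr pZ.
  (* Comparing coefficients in P = Q (X - t) gives Q_s t = Q_(s-1) - P_s, where Q_(-1) = 0. *)
  have PE s : P`_s = (if s is s'.+1 then Q`_s' else 0) - Q`_s * t.
    by rewrite PQ mulrBr coefB coefMC coefMX; case: s.
  pose d := (Q.[t])^-1.
  have -> : \sum_s phi (p s) (q s * t) =
      \sum_(s < size P) phi (t ^+ s) ((if s : nat is s'.+1 then Q`_s' else 0) * d)
      - \sum_(s < size P) phi (t ^+ s) (P`_s * d).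
    have phiN x y : phi x (- y) = - phi x y.
      by apply: (addrI (phi x y)); rewrite -pDr !subrr;
         apply: (addrI (phi x 0)); rewrite -pDr !addr0.
    rewrite -sumrB; apply: eq_bigr => s _; rewrite -phiN -pDr PE -mulrBl subKr.
    by rewrite /q mulrAC.
  (* The P_s lie in k, so they move to the first argument, where they add up to P(t) = 0. *)
  have -> : \sum_(s < size P) phi (t ^+ s) (P`_s * d) = 0.
    rewrite (eq_bigr (fun s : 'I_(size P) => phi (P`_s * t ^+ s) d)); last first.
      by move=> s _; rewrite coefP !mulr_algl pZ.
    rewrite -(balanced_suml _ _ _ bphi) -horner_coef (rootP Pt).
    by apply: (addrI (phi 0 d)); rewrite -pDl !addr0.
  have phi0 x : phi x 0 = 0 by apply: (addrI (phi x 0)); rewrite -pDr !addr0.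
  (* The two sums agree after a shift by one: the last term on the left contains the coefficient of
     Q at index [size Q] and the first on the right contains Q_(-1), both zero. *)
  rewrite subr0 /p /q szP big_ord_recr [RHS]big_ord_recl /=.
  rewrite nth_default // !mul0r !phi0 addr0 add0r.
  by apply: eq_bigr => s _; rewrite exprS.
suff cent x : central x by move=> V phi bphi x; apply: cent.
have : x \in <<1%VS; t>>%VS by rewrite -Kt memvf.
move=> /Fadjoin_polyP[_ /polyOver1P[r ->] ->].
elim/poly_ind: r => [|r a IHr].
  by rewrite rmorph0 horner0 -(scale0r 1); apply: centralC.
rewrite rmorphD rmorphM /= map_polyX map_polyC !hornerE.
by apply: centralD; [apply: centralM | apply: centralC].
Qed.

End SeparabilityIdempotent.

(** * Restriction and extension of scalars *)

Section AddChain.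

Variable B : nzRingType.

Section Add.

Variables (X Y : complex B) (f g : chain_map X Y).

Fact add_chainE i j x : (f j \+ g j) (cdiff X i j x) = cdiff Y i j ((f i \+ g i) x).
Proof. by rewrite /= linearD !cmapE. Qed.

Definition add_chain : chain_map X Y :=
  @ChainMap B X Y (fun i => (f i \+ g i : {linear _ -> _})) add_chainE.

End Add.

Lemma retract_dsum_of_sum (Z X Y : complex B) (a : chain_map Z X) (a' : chain_map X Z)
    (b : chain_map Z Y) (b' : chain_map Y Z) :
  (forall i z, a' i (a i z) + b' i (b i z) = z) -> retract Z (dsum X Y).
Proof.
move=> abE; exists (add_chain (comp_chain (dsum_inl X Y) a) (comp_chain (dsum_inr X Y) b)).
exists (add_chain (comp_chain a' (dsum_fst X Y)) (comp_chain b' (dsum_snd X Y))) => i z.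
by rewrite /= addr0 add0r abE.
Qed.

Lemma fin_generatedT (M : lmodType B) (T : finType) (e : T -> M) :
  (forall x, exists c : T -> B, x = \sum_t c t *: e t) -> fin_generated M.
Proof.
move=> spane; exists #|T|, (fun s => e (enum_val s)) => x.
have [c ->] := spane x; exists (fun s => c (enum_val s)).
by rewrite (sum_enum_val (fun t => c t *: e t)).
Qed.

End AddChain.

Section ScalarExtensionModules.

Variables (k : fieldType) (A : falgType k) (K : fieldExtType k).
Local Notation B := (scalar_ext A K).
Local Notation n := (\dim {:K}).
Local Notation kappa s := ((vbasis {:K})`_s).

Definition tens_left (a : A) : B := tens a 1.

Fact tens_left_zmod_morphism : zmod_morphism tens_left.
Proof.
move=> a b; rewrite /tens_left tensDl; congr (_ + _).
by rewrite -scaleN1r tensZl scaleN1r; apply/rowP => i; rewrite !mxE scalerN.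
Qed.

Fact tens_left_monoid_morphism : monoid_morphism tens_left.
Proof. by split=> [|a b]; rewrite /tens_left ?tens11 ?tensM ?mulr1. Qed.

HB.instance Definition _ := GRing.isZmodMorphism.Build A B tens_left tens_left_zmod_morphism.
HB.instance Definition _ := GRing.isMonoidMorphism.Build A B tens_left tens_left_monoid_morphism.

Lemma tensE a x : tens a x = tens_left a * tens 1 x :> B.
Proof. by rewrite tensM mulr1 mul1r. Qed.

Lemma tens_comm a x : tens_left a * tens 1 x = tens 1 x * tens_left a.
Proof. by rewrite !tensM !mulr1 !mul1r. Qed.

Lemma tens_alg (c : k) : tens_left c%:A = tens 1 c%:A.
Proof. exact: tensZl. Qed.

Lemma scalar_ext_ind (P : B -> Prop) :
  (forall b b', P b -> P b' -> P (b + b')) -> (forall a x, P (tens a x)) -> forall b, P b.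
Proof.
move=> PD Pt b; rewrite (scalar_ext_decomp b); elim/big_ind: _ => //.
by rewrite -(raddf0 tens_left); apply: Pt.
Qed.

Lemma scalar_ext_split b :
  exists a : 'I_n -> A, b = \sum_s tens_left (a s) * tens 1 (kappa s).
Proof.
elim/scalar_ext_ind: b => [b b' [a ->] [a' ->]|a x].
  exists (fun s => a s + a' s); rewrite -big_split; apply: eq_bigr => s _.
  by rewrite raddfD mulrDl.
exists (fun s => coord (vbasis {:K}) s x *: a).
rewrite {1}(coord_vbasis (memvf x)) tens_sumr; apply: eq_bigr => s _.
by rewrite -tensZl tensE.
Qed.

(** B is additively generated by products of elements of A and K, so linearity is tested on these
    two actions. *)
Lemma tens_linear (V W : lmodType B) (f : V -> W) :
  (forall u v, f (u + v) = f u + f v) ->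
  (forall a v, f (tens_left a *: v) = tens_left a *: f v) ->
  (forall x v, f (tens 1 x *: v) = tens 1 x *: f v) -> linear f.
Proof.
move=> fD fA fK b u v; rewrite fD; congr (_ + _).
elim/scalar_ext_ind: b => [b b' IHb IHb'|a x]; first by rewrite !scalerDl fD IHb IHb'.
by rewrite tensE -!scalerA fA fK.
Qed.

Local Notation res := (restr tens_left).

Lemma resE (V : lmodType B) a (v : res V) : a *: v = (tens_left a *: (v : V) : V).
Proof. by []. Qed.

Lemma restr_fin_generated (V : lmodType B) : fin_generated V -> fin_generated (res V).
Proof.
move=> [r [e spane]].
apply: (@fin_generatedT _ _ ('I_n * 'I_r)%type
  (fun t => (tens 1 (kappa t.1) : B) *: (e t.2 : V) : res V)) => x.
have [c xE] := spane x.
have /fin_all_exists[a cE] j := scalar_ext_split (c j).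
exists (fun t => a t.2 t.1).
rewrite -(pair_bigA _ (fun (s : 'I_n) (j : 'I_r) =>
  a j s *: ((tens 1 (kappa s) : B) *: (e j : V) : res V))) exchange_big /=.
rewrite {1}xE; apply: eq_bigr => j _; rewrite {1}cE scaler_suml.
by apply: eq_bigr => s _; rewrite resE scalerA.
Qed.

Lemma fin_generated_restr (V : lmodType B) : fin_generated (res V) -> fin_generated V.
Proof.
by move=> [r [e spane]]; exists r, e => x; have [c xE] := spane x; exists (tens_left \o c).
Qed.

Definition ext (M : lmodType A) : Type := {ffun 'I_n -> M}.

Section Ext.

Variable M : lmodType A.

HB.instance Definition _ := GRing.Zmodule.copy (ext M) {ffun 'I_n -> M}.

Implicit Types v w : ext M.

(* An element v of [ext M] stands for the k-linear map [ev v : K -> M] with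
   [ev v (kappa s) = v s], so that [ext M] is Hom_k(K, M), with K acting by
   (x v)(y) = v(x y). *)
Definition ev v (x : K) : fmod M := \sum_s coord (vbasis {:K}) s x *: (v s : fmod M).

Fact ev_linear v : linear (ev v).
Proof.
move=> c x y; rewrite /ev scaler_sumr -big_split; apply: eq_bigr => s _ /=.
by rewrite linearP /= scalerDl scalerA.
Qed.

HB.instance Definition _ v := GRing.isLinear.Build k K (fmod M) *:%R (ev v) (ev_linear v).

Lemma extD v w (s : 'I_n) : (v + w) s = v s + w s.
Proof. exact: ffunE. Qed.

Lemma evD v w x : ev (v + w) x = ev v x + ev w x.
Proof.
by rewrite /ev -big_split; apply: eq_bigr => s _; rewrite extD /= scalerDr.
Qed.

Lemma ev_kappa v (s : 'I_n) : ev v (kappa s) = v s.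
Proof.
rewrite /ev (bigD1 s) //= coord_free ?(basis_free (vbasisP _)) // eqxx scale1r.
rewrite big1 ?addr0 // => t ts.
by rewrite coord_free ?(basis_free (vbasisP _)) // eq_sym (negPf ts) scale0r.
Qed.

Lemma ev_inj v w : (forall x, ev v x = ev w x) -> v = w.
Proof. by move=> vw; apply/ffunP => s; rewrite -!ev_kappa vw. Qed.

(** A k-linear map is determined on the basis; this extends formulas given at the [kappa s] to all
    of K. *)
Lemma ev_finfun (f : {linear K -> fmod M}) : ev ([ffun s : 'I_n => f (kappa s) : M] : ext M) =1 f.
Proof.
move=> x; rewrite [in RHS](coord_vbasis (memvf x)) linear_sum; apply: eq_bigr => s _.
by rewrite ffunE linearZ.
Qed.

(** For b = \sum_i e_i \otimes b_i this is (b v)(y) = \sum_i e_i v(b_i y), recorded at y =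
    [kappa s]. *)
Definition ext_scale (b : B) v : ext M :=
  [ffun s : 'I_n => \sum_(i < \dim {:A}) (vbasis {:A})`_i *: (ev v (b 0 i * kappa s) : M)].

Lemma ev_scale b v y :
  ev (ext_scale b v) y = \sum_(i < \dim {:A}) (vbasis {:A})`_i *: (ev v (b 0 i * y) : M).
Proof.
pose f y : fmod M := \sum_(i < \dim {:A}) (vbasis {:A})`_i *: (ev v (b 0 i * y) : M).
have fl : linear f.
  move=> c x x'; rewrite /f fmodE scaler_sumr -big_split; apply: eq_bigr => i _.
  by rewrite mulrDr linearD -scalerAr linearZ /= scalerDr fmodE algZC.
pose f' : {linear K -> fmod M} :=
  HB.pack f (GRing.isLinear.Build k K (fmod M) *:%R f fl).
exact: (ev_finfun f').
Qed.

Lemma ev_tens a x v y : ev (ext_scale (tens a x) v) y = a *: (ev v (x * y) : M).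
Proof.
rewrite ev_scale {2}(coord_vbasis (memvf a)) scaler_suml; apply: eq_bigr => i _.
by rewrite mxE -scalerAl linearZ /= fmodE scalerA mulr_algr.
Qed.

Fact ext_scaleDl v : {morph ext_scale^~ v : b b' / b + b'}.
Proof.
move=> b b'; apply: ev_inj => y; rewrite evD !ev_scale -big_split; apply: eq_bigr => i _.
by rewrite mxE mulrDl linearD scalerDr.
Qed.

Fact ext_scaleDr : right_distributive ext_scale +%R.
Proof.
move=> b v w; apply: ev_inj => y; rewrite evD !ev_scale -big_split; apply: eq_bigr => i _.
by rewrite evD scalerDr.
Qed.

Fact ext_scale1 : left_id 1 ext_scale.
Proof. by move=> v; apply: ev_inj => y; rewrite -tens11 ev_tens mul1r scale1r. Qed.

Fact ext_scaleA b b' v : ext_scale b (ext_scale b' v) = ext_scale (b * b') v.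
Proof.
elim/scalar_ext_ind: b => [b c IHb IHc|a x].
  by rewrite mulrDl !ext_scaleDl IHb IHc.
elim/scalar_ext_ind: b' => [b c IHb IHc|a' x'].
  by rewrite mulrDr !ext_scaleDl ext_scaleDr IHb IHc.
by apply: ev_inj => y; rewrite tensM !ev_tens scalerA mulrA [x' * x]mulrC.
Qed.

HB.instance Definition _ := GRing.Zmodule_isLmodule.Build B (ext M)
  ext_scaleA ext_scale1 ext_scaleDr ext_scaleDl.

Lemma ev_left a v y : ev (tens_left a *: v) y = a *: (ev v y : M).
Proof. by rewrite [LHS]ev_tens mul1r. Qed.

Lemma ev_right x v y : ev ((tens 1 x : B) *: v) y = ev v (x * y).
Proof. by rewrite [LHS]ev_tens scale1r. Qed.

Lemma ext_left a v s : (tens_left a *: v) s = a *: v s.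
Proof. by rewrite -ev_kappa ev_left ev_kappa. Qed.

(** With [ext_coord], this identifies the restriction of [ext M] to A with M^n. *)
Definition ext_inj (s : 'I_n) (x : M) : res (ext M) := [ffun t => if t == s then x else 0].

Fact ext_inj_linear s : linear (ext_inj s).
Proof.
move=> a x y; apply/ffunP => t; rewrite extD resE ext_left !ffunE.
by case: eqP; rewrite ?scaler0 ?addr0.
Qed.

HB.instance Definition _ s :=
  GRing.isLinear.Build A M (res (ext M)) *:%R (ext_inj s) (ext_inj_linear s).

Definition ext_coord (s : 'I_n) (v : res (ext M)) : M := (v : ext M) s.

Fact ext_coord_linear s : linear (ext_coord s).
Proof. by move=> a u v; rewrite /ext_coord extD resE ext_left. Qed.

HB.instance Definition _ s :=
  GRing.isLinear.Build A (res (ext M)) M *:%R (ext_coord s) (ext_coord_linear s).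

Lemma ext_sum_inj (v : res (ext M)) : v = \sum_s ext_inj s (ext_coord s v).
Proof.
apply/ffunP => t; rewrite sum_ffunE (bigD1 t) //= big1 => [|s st].
  by rewrite ffunE eqxx addr0.
by rewrite ffunE eq_sym (negPf st).
Qed.

Lemma ext_fin_generated : fin_generated M -> fin_generated (ext M).
Proof.
move=> [r [e spane]]; apply/fin_generated_restr.
apply: (@fin_generatedT _ _ ('I_n * 'I_r)%type (fun t => ext_inj t.1 (e t.2))) => v.
have /fin_all_exists[c cE] s := spane (ext_coord s v).
exists (fun t => c t.1 t.2).
rewrite -(pair_bigA _ (fun (s : 'I_n) (j : 'I_r) => c s j *: ext_inj s (e j))) /=.
rewrite {1}[v]ext_sum_inj; apply: eq_bigr => s _; rewrite cE linear_sum.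
by apply: eq_bigr => j _; rewrite linearZ.
Qed.

End Ext.

End ScalarExtensionModules.

Section ExtMap.

Variables (k : fieldType) (A : falgType k) (K : fieldExtType k).
Local Notation B := (scalar_ext A K).
Local Notation n := (\dim {:K}).
Local Notation kappa s := ((vbasis {:K})`_s).
Local Notation iota := (tens_left K : {rmorphism A -> B}).
Local Notation res := (restr iota).

Lemma restr_linearZ (V : lmodType B) (N : lmodType A) (f : {linear res V -> N}) a (v : V) :
  f (tens_left K a *: v) = a *: f v.
Proof. by rewrite -[_ *: v]/(a *: (v : res V)) linearZ. Qed.

Section Map.

Variables (M N : lmodType A) (f : {linear M -> N}).

Definition ext_map (v : ext K M) : ext K N := [ffun s => f (v s)].

Lemma ext_mapE v s : ext_map v s = f (v s). Proof. exact: ffunE. Qed.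

Lemma ev_ext_map v x : ev (ext_map v) x = f (ev v x).
Proof.
by rewrite /ev linear_comb; apply: eq_bigr => s _; rewrite ext_mapE.
Qed.

Fact ext_map_linear : linear ext_map.
Proof.
apply: tens_linear => [u v|a v|x v]; apply: ev_inj => y.
- by rewrite evD !ev_ext_map evD linearD.
- by rewrite ev_left !ev_ext_map ev_left linearZ.
by rewrite ev_right !ev_ext_map ev_right.
Qed.

HB.instance Definition _ :=
  GRing.isLinear.Build B (ext K M) (ext K N) *:%R ext_map ext_map_linear.

End Map.

(* The adjunction Hom_A(res V, N) = Hom_B(V, ext N). *)
Section Adjoint.

Variables (V : lmodType B) (N : lmodType A) (f : {linear res V -> N}).

Definition ext_adj (y : V) : ext K N := [ffun s : 'I_n => f ((tens 1 (kappa s) : B) *: y)].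

Lemma ev_ext_adj y x : ev (ext_adj y) x = f ((tens 1 x : B) *: y).
Proof.
pose g x : fmod N := f ((tens 1 x : B) *: y).
have gl : linear g.
  move=> c u v; rewrite /g tensDr scalerDl [f _]linearD; congr (_ + _).
  by rewrite -tensZl (tensE (c *: 1)) -scalerA restr_linearZ.
pose g' : {linear K -> fmod N} :=
  HB.pack g (GRing.isLinear.Build k K (fmod N) *:%R g gl).
exact: (ev_finfun g').
Qed.

Fact ext_adj_linear : linear ext_adj.
Proof.
apply: tens_linear => [u v|a v|x v]; apply: ev_inj => y.
- by rewrite evD !ev_ext_adj scalerDr linearD.
- rewrite ev_left !ev_ext_adj scalerA -tens_comm -scalerA.
  by rewrite restr_linearZ.
by rewrite ev_right !ev_ext_adj scalerA tensM mul1r mulrC.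
Qed.

HB.instance Definition _ :=
  GRing.isLinear.Build B V (ext K N) *:%R ext_adj ext_adj_linear.

End Adjoint.

Section Average.

Variables (m : nat) (p q : 'I_m -> K).
Hypothesis pqP : separability_idempotent p q.
Variables (V W : lmodType B) (h : {linear res V -> res W}).

(** Averaging makes an A-linear [h] B-linear: it keeps A-linearity, and centrality of the idempotent
    gives K-linearity. *)
Definition average (v : V) : W :=
  \sum_s (tens 1 (p s) : B) *: (h ((tens 1 (q s) : B) *: v) : W).

Fact average_linear : linear average.
Proof.
apply: tens_linear => [u v|a v|x v]; rewrite /average.
- rewrite -big_split; apply: eq_bigr => s _.
  by rewrite scalerDr [h _]linearD scalerDr.
- rewrite scaler_sumr; apply: eq_bigr => s _.
  rewrite scalerA -tens_comm -scalerA restr_linearZ.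
  by rewrite resE !scalerA tens_comm.
(* This map is balanced because k also acts through A, over which [h] is linear. *)
pose phi (x y : K) : W := (tens 1 x : B) *: (h ((tens 1 y : B) *: v) : W).
have bphi : balanced phi.
  split=> [y y' z|y z z'|c y z]; rewrite /phi.
  - by rewrite tensDr scalerDl.
  - by rewrite tensDr scalerDl [h _]linearD scalerDr.
  rewrite -!tensZl !(tensE (c *: 1)).
  by rewrite -[in RHS](scalerA _ _ v) restr_linearZ resE scalerA tens_comm.
have := proj2 pqP _ _ bphi x; rewrite /phi => E.
under eq_bigr => s _ do rewrite scalerA tensM mul1r.
rewrite -E scaler_sumr; apply: eq_bigr => s _.
by rewrite scalerA tensM mul1r.
Qed.

Definition average_map : {linear V -> W} :=
  HB.pack average (GRing.isLinear.Build B V W *:%R average average_linear).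

(** On such [v] the summands are p_s q_s w, and \sum_s p_s q_s = 1. *)
Lemma average_id (v : V) (w : W) : (forall x, h ((tens 1 x : B) *: v) = (tens 1 x : B) *: w) ->
  average_map v = w.
Proof.
move=> hv; rewrite /= /average.
under eq_bigr => s _ do rewrite hv scalerA tensM mul1r.
by rewrite -scaler_suml -tens_sumr (proj1 pqP) tens11 scale1r.
Qed.

End Average.

Section Projective.

Variables (m : nat) (p q : 'I_m -> K).
Hypothesis pqP : separability_idempotent p q.

(* A lift over A becomes B-linear after averaging. *)
Lemma projective_of_restr (V : lmodType B) : projective (res V) -> projective V.
Proof.
move=> projV M N g f g_surj.
have [h hE] := projV (res M) (res N) (restr_map g) (restr_map f) g_surj.
have hE' (v : V) : g (h v) = f v := hE v.
exists (average_map pqP h) => v; rewrite /average /= linear_sum.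
rewrite -[RHS]scale1r -tens11 -(proj1 pqP) tens_sumr scaler_suml.
apply: eq_bigr => s _; rewrite linearZ.
by rewrite /= hE' linearZ /= scalerA tensM mul1r.
Qed.

(** Over A the module [ext K P] is P^n, so lifts on the copies of P add up; [projective_of_restr]
    then returns to B. *)
Lemma ext_projective (P : lmodType A) : projective P -> projective (ext K P).
Proof.
move=> projP; apply: projective_of_restr => M N g f g_surj.
have /fin_all_exists[h hE] (s : 'I_n) : exists h : {linear P -> M},
    forall x, g (h x) = f (ext_inj s x).
  exact: (projP M N g (f \o @ext_inj _ _ K P s : {linear _ -> _})).
pose H (v : res (ext K P)) : M := \sum_s h s (ext_coord s v).
have Hl : linear H.
  move=> a u v; rewrite /H scaler_sumr -big_split; apply: eq_bigr => s _.
  by rewrite !linearP.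
pose H' : {linear res (ext K P) -> M} :=
  HB.pack H (GRing.isLinear.Build A (res (ext K P)) M *:%R H Hl).
exists H' => v; rewrite /= /H linear_sum {2}[v]ext_sum_inj linear_sum.
by apply: eq_bigr => s _; rewrite hE.
Qed.

(** The adjoint of f maps Q to [ext K N], lifts to [ext K M] because [ext_map g] is surjective, and
    the lift evaluated at 1 is the required map. *)
Lemma restr_projective (Q : lmodType B) : projective Q -> projective (res Q).
Proof.
move=> projQ M N g f g_surj.
have ext_g_surj (w : ext K N) : exists v, ext_map g v = w.
  have /fin_all_exists[v vE] s := g_surj (w s).
  by exists (finfun v); apply/ffunP => s; rewrite ext_mapE ffunE.
have [h hE] := projQ (ext K M) (ext K N) (ext_map g) (ext_adj f) ext_g_surj.
pose H (y : res Q) : M := ev (h y) 1.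
have Hl : linear H.
  by move=> a u v; rewrite /H resE linearP evD ev_left.
pose H' : {linear res Q -> M} :=
  HB.pack H (GRing.isLinear.Build A (res Q) M *:%R H Hl).
exists (H' : {linear res Q -> M}) => y; rewrite /= /H -ev_ext_map hE ev_ext_adj.
by rewrite tens11 scale1r.
Qed.

End Projective.

End ExtMap.

(** * Radicals and complexes under change of scalars *)

Lemma maximal_preim (R : nzRingType) (M M' : lmodType R) (f : {linear M -> M'})
    (g : {linear M' -> M}) (N : M' -> Prop) :
  cancel f g -> cancel g f -> maximal N -> maximal (fun x => N (f x)).
Proof.
move=> fK gK [sN [y nNy] maxN]; split; first exact: submodule_preim.
  by exists (g y); rewrite gK.
move=> N' sN' NN' [x N'x nNfx] z; rewrite -(fK z).
apply: (maxN (fun x => N' (g x))) => [|t Nt|]; first exact: submodule_preim.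
  by apply: NN'; rewrite gK.
by exists (f x); rewrite ?fK.
Qed.

(* The quotient by finitely many maximal submodules is semisimple. *)
Lemma complement_mod_maximal (R : nzRingType) (M : lmodType R) (U : M -> Prop)
    r (N : nat -> M -> Prop) :
  submodule U -> (forall s, (s < r)%N -> maximal (N s)) ->
  exists W : M -> Prop, [/\ submodule W, forall x, submod_add U W x
    & forall x, U x -> W x -> forall s, (s < r)%N -> N s x].
Proof.
move=> sU; elim: r => [|r IHr] maxN.
  exists (fun=> True); split=> // x; exists 0 => //; exact: submod0.
have [s lt_sr|W [sW UW UWN]] := IHr; first by apply: maxN; apply: ltnW.
have [sNr _ mNr] := maxN r (ltnSn r).
have [UWNr|/existsNP[u nUWNu]] := pselect (forall x, U x -> W x -> N r x).
  exists W; split=> // x Ux Wx s; rewrite ltnS leq_eqVlt => /predU1P[->|lt_sr].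
    exact: UWNr.
  exact: UWN.
have [Uu [Wu nNu]] : U u /\ W u /\ ~ N r u.
  split; [|split]; last by move=> Nu; apply: nUWNu.
    by apply: contrapT => nUu; apply: nUWNu => /nUu.
  by apply: contrapT => nWu; apply: nUWNu => _ /nWu.
exists (fun x => W x /\ N r x); split.
- split=> [|a x y [Wx Nx] [Wy Ny]]; first by split; apply: submod0.
  by split; [apply: (proj2 sW) | apply: (proj2 sNr)].
(* By maximality the sum of U \cap W and N_r is everything. Splitting x - u1, which lies in W, as u2
   modulo N_r leaves a remainder in W \cap N_r. *)
- move=> x; have [u1 Uu1 Wu1] := UW x.
  pose UW' y := U y /\ W y.
  have sUW' : submodule UW'.
    split=> [|a y z [Uy Wy] [Uz Wz]]; first by split; apply: submod0.
    by split; [apply: (proj2 sU) | apply: (proj2 sW)].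
  have [||u2 [Uu2 Wu2] Nu2] := mNr _ (submodule_add sUW' sNr) _ _ (x - u1).
  + by move=> y Ny; exists 0; [apply: submod0 | rewrite subr0].
  + by exists u => //; exists u; [split | rewrite subrr; apply: submod0].
  exists (u1 + u2); first exact: submodD.
  by rewrite opprD addrA; split=> //; apply: submodB.
move=> x Ux [Wx Nx] s; rewrite ltnS leq_eqVlt => /predU1P[->//|].
exact: UWN.
Qed.

Section Radical.

Variables (k : fieldType) (A : falgType k) (K : fieldExtType k).
Local Notation B := (scalar_ext A K).
Local Notation n := (\dim {:K}).
Local Notation kappa s := ((vbasis {:K})`_s).
Local Notation iota := (tens_left K : {rmorphism A -> B}).
Local Notation res := (restr iota).

Definition scalar_mul (V : lmodType B) (x : K) (v : res V) : res V :=
  (tens 1 x : B) *: (v : V).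

Fact scalar_mul_linear V x : linear (@scalar_mul V x).
Proof.
move=> a u v; rewrite /scalar_mul scalerDr; congr (_ + _).
by rewrite !resE !scalerA tens_comm.
Qed.

HB.instance Definition _ V x :=
  GRing.isLinear.Build A (res V) (res V) *:%R (@scalar_mul V x) (@scalar_mul_linear V x).

Lemma scalar_mulK V x : x != 0 -> cancel (@scalar_mul V x) (@scalar_mul V x^-1).
Proof.
by move=> x0 v; rewrite /scalar_mul scalerA tensM mul1r mulVf // tens11 scale1r.
Qed.

(** If a maximal B-submodule N misses v, then B v + N = V. But a maximal A-submodule above N
    contains B v too, since multiplication by [kappa s] is A-linear and preserves the radical over
    A. *)
Lemma in_rad_of_restr (V : lmodType B) (v : V) :
  fin_generated V -> in_rad (v : res V) -> in_rad v.
Proof.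
move=> fgV radv; apply/in_radP => N [sN [x nNx] maxN]; apply: contrapT => nNv.
have sNA : submodule (N : res V -> Prop).
  by case: sN => N0 NZ; split=> // a u w; apply: NZ.
have [N1 maxN1 NN1] := proper_sub_maximal (restr_fin_generated fgV) sNA (ex_intro _ x nNx).
have [sN1 [z nN1z] _] := maxN1.
pose Bv w := exists b : B, w = b *: v.
have sBv : submodule Bv.
  split=> [|a _ _ [b ->] [b' ->]]; first by exists 0; rewrite scale0r.
  by exists (a * b + b'); rewrite scalerDl scalerA.
have [||_ [b ->] Nzb] := maxN _ (submodule_add sBv sN) _ _ z.
- by move=> w Nw; exists 0; [apply: submod0 | rewrite subr0].
- by exists v => //; exists v; [exists 1; rewrite scale1r | rewrite subrr; apply: submod0].
apply: nN1z; apply: (submod_shift sN1 (NN1 _ Nzb)).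
have [a ->] := scalar_ext_split b; rewrite scaler_suml.
apply: (submod_sum sN1) => s _; rewrite -scalerA.
apply: (submodZ sN1 (a s) (x := (tens 1 (kappa s) : B) *: v : res V)).
move/in_radP: (in_rad_map (@scalar_mul V (kappa s)) radv); exact.
Qed.

(** Suppose a maximal A-submodule N misses y. A projection of V onto its B-radical U, taken modulo a
    B-submodule N' of N, is averaged to a B-linear map that is the quotient map on U. Its kernel is
    proper, so a maximal B-submodule contains it, and also U; but the kernel and U add up to V. *)
Lemma in_rad_restr m (p q : 'I_m -> K) (V : lmodType B) (y : V) :
  separability_idempotent p q ->
  fin_generated V -> in_rad y -> in_rad (y : res V).
Proof.
move=> pqP fgV rady; apply/in_radP => N maxN; apply: contrapT => nNy.
have [sN _ _] := maxN.
pose U (v : res V) := in_rad (v : V).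
have sU : submodule U.
  split=> [|a u v radu radv]; first exact: (submod0 (in_rad_submodule V)).
  exact: (proj2 (in_rad_submodule V) (tens_left K a) u v radu radv).
have [|W [sW UW UWN]] := @complement_mod_maximal _ (res V) U n
    (fun s v => N (scalar_mul (kappa s) v)) sU _.
  move=> s lt_s; have k0 : kappa s != 0.
    have /free_not0 : free (vbasis {:K}) := basis_free (vbasisP _).
    by apply; rewrite mem_nth ?size_tuple.
  apply: (maximal_preim (scalar_mulK k0) _ maxN).
  by rewrite -{2}[kappa s]invrK; apply: scalar_mulK; rewrite invr_eq0.
(* This is the largest B-submodule inside N. As the [kappa s] generate B over A, it contains U \cap
   W. *)
pose N' (v : V) := forall b : B, N (b *: v).
have sN' : submodule N'.
  split=> [|a u v N'u N'v] b; first by rewrite scaler0; exact: (submod0 sN).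
  by rewrite scalerDr scalerA; apply: (submodD sN); [apply: N'u | apply: N'v].
have UWN' v : U v -> W v -> N' v.
  move=> Uv Wv b; have [a ->] := scalar_ext_split b; rewrite scaler_suml.
  apply: (submod_sum sN) => s _; rewrite -scalerA.
  exact: (submodZ sN (a s) (x := (tens 1 (kappa s) : B) *: v : res V) (UWN _ Uv Wv _ (ltn_ord s))).
(* The chosen U-component [f v] is determined modulo U \cap W, hence modulo N', which makes [h]
   linear. *)
have /choice[f fP] (v : res V) : exists u, U u /\ W (v - u).
  by have [u] := UW v; exists u.
pose Q : lmodType B := quot_module sN'.
pose h (v : res V) : res Q := quot_pi sN' (f v).
have hl : linear h.
  move=> a u v; rewrite /h resE -linearZ -linearD; apply/quot_pi_eq.
  have [Uu Wu] := fP u; have [Uv Wv] := fP v; have [Uuv Wuv] := fP (a *: u + v).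
  apply: UWN'.
    apply: (submodB sU Uuv); exact: (proj2 sU a _ _ Uu Uv).
  have := submodB sW (proj2 sW a _ _ Wu Wv) Wuv.
  by rewrite scalerBr addrACA -opprD opprB [X in W X -> _]addrC addrA subrK.
pose h' : {linear res V -> res Q} :=
  HB.pack h (GRing.isLinear.Build A (res V) (res Q) *:%R h hl).
have hU v : U v -> h v = quot_pi sN' v.
  move=> Uv; have [Ufv Wfv] := fP v; apply/esym/quot_pi_eq.
  by apply: UWN' => //; exact: (submodB sU Uv Ufv).
have avgU v : U v -> average_map pqP h' v = quot_pi sN' v.
  move=> Uv; apply: average_id => x; rewrite -linearZ; apply: hU.
  exact: (submodZ (in_rad_submodule V)).
have [z nz] : exists z, ~ (average_map pqP h' z = 0).
  exists y; rewrite avgU // => /quot_pi_eq0/(_ 1); rewrite scale1r.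
  exact: nNy.
have sK : submodule (fun v => average_map pqP h' v = 0).
  by split=> [|a u v u0 v0]; [rewrite linear0 | rewrite linearP u0 v0 scaler0 addr0].
have [N1 [sN1 [t nN1t] mN1] KN1] := proper_sub_maximal fgV sK (ex_intro _ z nz).
have UN1 v : U v -> N1 v by move=> /in_radP; apply; split=> //; exists t.
apply: nN1t.
(* This element of U represents the averaged value at t, so t - u lies in the kernel of the averaged
   map. *)
pose u := \sum_s (tens 1 (p s) : B) *: (f ((tens 1 (q s) : B) *: t) : V).
have Uu : U u.
  apply: (submod_sum (in_rad_submodule V)) => s _; apply: (submodZ (in_rad_submodule V)).
  by case: (fP ((tens 1 (q s) : B) *: t)).
apply: (submod_shift sN1 (y := u)); last exact: UN1.
have piu : quot_pi sN' u = average_map pqP h' t.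
  by rewrite /u linear_sum; apply: eq_bigr => s _; rewrite linearZ.
by apply: KN1; rewrite linearB (avgU u Uu) piu subrr.
Qed.

End Radical.

(** * Extension and restriction of complexes *)

Section Functors.

Variables (k : fieldType) (A : falgType k) (K : fieldExtType k).
Local Notation B := (scalar_ext A K).
Local Notation n := (\dim {:K}).
Local Notation kappa s := ((vbasis {:K})`_s).
Local Notation iota := (tens_left K : {rmorphism A -> B}).
Local Notation res := (restr iota).

Lemma coh_spanT (F : fieldType) (C : falgType F) (X : complex C) i (T : finType)
    (e : T -> fmod (X i)) : (forall t, cocycle (e t)) ->
  (forall x : X i, cocycle x -> exists c : T -> F, coboundary (x - \sum_t c t *: e t)) ->
  coh_span X i #|T|.
Proof.
move=> ze se; exists (fun s => e (enum_val s)) => // x /se[c Dc].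
exists (fun s => c (enum_val s)).
by rewrite (sum_enum_val (fun t => c t *: e t)).
Qed.

Section RestrComplex.

Variable X : complex B.

Fact restr_diff_shape i j : j != i + 1 -> forall x, restr_map (phi := iota) (cdiff X i j) x = 0.
Proof. by move=> ij x; rewrite /restr_map cdiff_shape. Qed.

Fact restr_diffK i j l x :
  restr_map (phi := iota) (cdiff X j l) (restr_map (phi := iota) (cdiff X i j) x) = 0.
Proof. by rewrite /restr_map cdiffK. Qed.

Definition restr_complex : complex A :=
  @Complex A (fun i => res (X i)) (fun i j => restr_map (phi := iota) (cdiff X i j))
    restr_diff_shape restr_diffK.

End RestrComplex.

Section ExtComplex.

Variable X : complex A.

Fact ext_diff_shape i j : j != i + 1 -> forall v, ext_map (K := K) (cdiff X i j) v = 0.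
Proof. by move=> ij v; apply/ffunP => s; rewrite ext_mapE cdiff_shape ?ffunE. Qed.

Fact ext_diffK i j l v :
  ext_map (K := K) (cdiff X j l) (ext_map (K := K) (cdiff X i j) v) = 0.
Proof. by apply/ffunP => s; rewrite !ext_mapE cdiffK ffunE. Qed.

Definition ext_complex : complex B :=
  @Complex B (fun i => ext K (X i)) (fun i j => ext_map (K := K) (cdiff X i j))
    ext_diff_shape ext_diffK.

End ExtComplex.

Definition restr_chain (X Y : complex B) (f : chain_map X Y) :
    chain_map (restr_complex X) (restr_complex Y) :=
  @ChainMap A (restr_complex X) (restr_complex Y)
    (fun i => restr_map (phi := iota) (f i)) (cmapE f).

Fact ext_chainE (X Y : complex A) (f : chain_map X Y) i j v :
  ext_map (K := K) (f j) (cdiff (ext_complex X) i j v) =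
  cdiff (ext_complex Y) i j (ext_map (K := K) (f i) v).
Proof. by apply/ffunP => s; rewrite /= !ext_mapE cmapE. Qed.

Definition ext_chain (X Y : complex A) (f : chain_map X Y) :
    chain_map (ext_complex X) (ext_complex Y) :=
  @ChainMap B (ext_complex X) (ext_complex Y)
    (fun i => ext_map (K := K) (f i)) (ext_chainE f).

Fact res_injE (X : complex A) (s : 'I_n) i j x :
  ext_inj s (cdiff X i j x) = cdiff (restr_complex (ext_complex X)) i j (ext_inj s x).
Proof.
apply/ffunP => t; rewrite /= /restr_map ext_mapE !ffunE.
by case: eqP; rewrite ?linear0.
Qed.

Fact res_coordE (X : complex A) (s : 'I_n) i j v :
  ext_coord s (cdiff (restr_complex (ext_complex X)) i j v) = cdiff X i j (ext_coord s v).
Proof. exact: ext_mapE. Qed.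

(** A single coordinate of M^n, available since n > 0, gives the inclusion and the projection. *)
Lemma retract_restr_ext (X : complex A) : retract X (restr_complex (ext_complex X)).
Proof.
have n0 : (0 < n)%N by rewrite adim_gt0.
exists (@ChainMap A X (restr_complex (ext_complex X))
  (fun i => @ext_inj _ _ K (X i) (Ordinal n0)) (@res_injE X (Ordinal n0))).
exists (@ChainMap A (restr_complex (ext_complex X)) X
  (fun i => @ext_coord _ _ K (X i) (Ordinal n0)) (@res_coordE X (Ordinal n0))) => i x.
by rewrite /= /ext_coord ffunE eqxx.
Qed.

Definition ext_ev1 (M : lmodType A) (v : res (ext K M)) : M := ev v 1.

Fact ext_ev1_linear M : linear (@ext_ev1 M).
Proof. by move=> a u v; rewrite /ext_ev1 evD resE ev_left. Qed.

HB.instance Definition _ M :=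
  GRing.isLinear.Build A (res (ext K M)) M *:%R (@ext_ev1 M) (@ext_ev1_linear M).

Section Separable.

Variables (m : nat) (p q : 'I_m -> K).
Hypothesis pqP : separability_idempotent p q.

(** The inclusion is the unit of the adjunction, y to (x to x y); its retraction is the average of
    evaluation at 1, which by itself is only A-linear. *)
Lemma retract_ext_restr (Y : complex B) : retract Y (ext_complex (restr_complex Y)).
Proof.
pose eta i : {linear Y i -> ext K (res (Y i))} := ext_adj (idfun : {linear res (Y i) -> res (Y i)}).
pose rho i : {linear ext K (res (Y i)) -> Y i} := average_map pqP (@ext_ev1 (res (Y i))).
have etaE i j y : eta j (cdiff Y i j y) = cdiff (ext_complex (restr_complex Y)) i j (eta i y).
  apply: ev_inj => x.
  by rewrite /= ev_ext_map !ev_ext_adj /= /restr_map linearZ.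
have rhoE i j v : rho j (cdiff (ext_complex (restr_complex Y)) i j v) = cdiff Y i j (rho i v).
  rewrite /= /average linear_sum; apply: eq_bigr => s _; rewrite linearZ; congr (_ *: _).
  have := @ev_ext_map _ _ K (res (Y i)) (res (Y j))
    (restr_map (phi := iota) (cdiff Y i j)) ((tens 1 (q s) : B) *: (v : ext K (res (Y i)))) 1.
  by rewrite linearZ.
exists (@ChainMap B Y (ext_complex (restr_complex Y)) eta etaE).
exists (@ChainMap B (ext_complex (restr_complex Y)) Y rho rhoE) => i y; apply: average_id => x.
by rewrite /= /ext_ev1 ev_right ev_ext_adj mulr1.
Qed.

(** Here [c] bounds the degrees, [m] is the length of the idempotent, and the dimension factor is n
    = [K : k]. *)
Lemma restr_functor c : Cm_functor c n restr_complex.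
Proof.
split=> [X Y [f [g fK]]|X Y|X X0|X [[projX bndX] minX vanX]|X i N [e ze se]].
- by exists (restr_chain f), (restr_chain g) => i x; apply: fK.
- apply: (retract_dsum_of_sum (a := restr_chain (dsum_fst X Y))
    (a' := restr_chain (dsum_inl X Y)) (b := restr_chain (dsum_snd X Y))
    (b' := restr_chain (dsum_inr X Y))) => i z.
  by rewrite [RHS](dsum_split (z : dsum X Y i)).
- by move=> i x; apply: X0.
- split; [split=> // i; case: (projX i) => fgX prX | move=> i x | exact: vanX].
    by split; [apply: restr_fin_generated | apply: restr_projective].
  by apply: (in_rad_restr pqP); [case: (projX (i + 1)) | apply: minX].
(* If the e_j span the cohomology over K, the products of the [kappa s] with the e_j span it over
   k. *)
rewrite -[n]card_ord -[N]card_ord -card_prod.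
apply: (@coh_spanT _ _ (restr_complex X) i _
  (fun t : 'I_n * 'I_N => (tens 1 (kappa t.1) : B) *: (e t.2 : X i) : fmod (res (X i)))).
  by move=> t; rewrite /cocycle /= /restr_map linearZ /= [cdiff _ _ _ _]ze scaler0.
move=> x /se[b Db]; exists (fun t => coord (vbasis {:K}) t.1 (b t.2)).
rewrite -(pair_bigA _ (fun (s : 'I_n) (j : 'I_N) => coord (vbasis {:K}) s (b j) *:
  ((tens 1 (kappa s) : B) *: (e j : X i) : fmod (res (X i))))) exchange_big /=.
rewrite (eq_bigr (fun j => b j *: e j)) // => j _.
rewrite [RHS]fmodE {2}(coord_vbasis (memvf (b j))) scaler_suml scaler_suml.
apply: eq_bigr => s _; rewrite fmodE resE scalerA -tensE tensZl.
by rewrite -tens11 tensZ mulr1.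
Qed.

Lemma ext_functor c : Cm_functor c n ext_complex.
Proof.
split=> [X Y [f [g fK]]|X Y|X X0|X [[projX bndX] minX vanX]|X i N [e ze se]].
- exists (ext_chain f), (ext_chain g) => i x.
  by apply/ffunP => s; rewrite /= !ext_mapE fK.
- apply: (retract_dsum_of_sum (a := ext_chain (dsum_fst X Y))
    (a' := ext_chain (dsum_inl X Y)) (b := ext_chain (dsum_snd X Y))
    (b' := ext_chain (dsum_inr X Y))) => i z.
  by apply/ffunP => s; rewrite extD !ext_mapE [RHS](dsum_split (z s)).
- by move=> i v; apply/ffunP => s; rewrite [LHS]X0 ffunE.
- have ext0 i : (forall x : X i, x = 0) -> forall v : ext K (X i), v = 0.
    by move=> x0 v; apply/ffunP => s; rewrite [LHS]x0 ffunE.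
  split; [split=> [i|] | move=> i v | by move=> i /vanX/ext0].
  + case: (projX i) => fgX prX.
    by split; [apply: ext_fin_generated | apply: (ext_projective pqP)].
  + by case: bndX => a [b bndX]; exists a, b => i /bndX/ext0.
  (* Over A, the differential of v is a sum of images under [ext_inj] of radical elements. *)
  apply: in_rad_of_restr; first by apply: ext_fin_generated; case: (projX (i + 1)).
  rewrite [X in in_rad X](ext_sum_inj (cdiff (ext_complex X) i (i + 1) v : res _)).
  apply: (submod_sum (in_rad_submodule _)) => s _; apply: in_rad_map.
  by rewrite [X in in_rad X]ext_mapE; apply: minX.
(* A cocycle of the extension is a family of n cocycles of X; coefficients and bounding elements are
   chosen in each coordinate. *)
rewrite -[n]card_ord -[N]card_ord -card_prod.
apply: (@coh_spanT _ _ (ext_complex X) i _ (fun t : 'I_n * 'I_N => ext_inj t.1 (e t.2))).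
  move=> t; apply/ffunP => s; rewrite [LHS]ext_mapE !ffunE.
  by case: eqP => _; rewrite ?linear0 // ze.
move=> v zv; have /fin_all_exists[b bE] (s : 'I_n) :
    spans_mod (V := fmod (X i)) (@coboundary A X i) e (v s).
  by apply: se; rewrite /cocycle -ext_mapE [LHS](congr1 (fun w : ext K _ => w s) zv) ffunE.
have /fin_all_exists[y yE] := bE.
exists (fun t => (b t.1 t.2)%:A); exists (finfun y).
rewrite -(pair_bigA _ (fun (s : 'I_n) (j : 'I_N) => (b s j)%:A *:
  (ext_inj s (e j) : fmod (ext K (X i))))) /=.
have -> : \sum_s \sum_j (b s j)%:A *: (ext_inj s (e j) : fmod (ext K (X i))) =
    [ffun s => \sum_j b s j *: e j] :> ext K (X i).
  rewrite [RHS](ext_sum_inj (_ : res (ext K (X i)))); apply: eq_bigr => s _.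
  rewrite /ext_coord ffunE linear_sum; apply: eq_bigr => j _.
  by rewrite !fmodE linearZ /= resE tens_alg -tens11 tensZ mulr1.
apply/ffunP => t; rewrite [LHS]ext_mapE [X in cdiff _ _ _ X]ffunE yE.
by rewrite -[RHS]/((v - _) t) !ffunE.
Qed.

End Separable.

End Functors.

Theorem proposition3p3 (k : fieldType) (A : falgType k) (K : fieldExtType k)
    (k_infinite : infinite_type k) (K_separable : separable 1%VS {:K}%VS) :
  [/\ forall m : nat, (0 < m)%N ->
        (finite_rep_type A m <-> finite_rep_type (scalar_ext A K) m),
      forall m : nat, (0 < m)%N ->
        (strongly_unbounded A m <-> strongly_unbounded (scalar_ext A K) m)
    & C_dichotomic A <-> C_dichotomic (scalar_ext A K)].
Proof.
have [r [p [q pqP]]] := separability_idempotent_exists K_separable.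
have funE m := ext_functor A pqP m.
have funR m := restr_functor A pqP m.
have retER := retract_ext_restr (A := A) pqP.
have retRE := fun X => retract_restr_ext K (X : complex A).
have finE m : finite_rep_type A m <-> finite_rep_type (scalar_ext A K) m.
  split; first exact: (finite_rep_type_transfer (funE m) (funR m) retER).
  exact: (finite_rep_type_transfer (funR m) (funE m) retRE).
have unbE m : strongly_unbounded A m <-> strongly_unbounded (scalar_ext A K) m.
  split; first exact: (strongly_unbounded_transfer (funE m) (funR m) retRE).
  exact: (strongly_unbounded_transfer (funR m) (funE m) retER).
split=> [m _|m _|]; [exact: finE | exact: unbE |].
by split=> -[fin|[m m0 unb]]; [left=> m /fin/finE | right; exists m => //; apply/unbE
  | left=> m /fin/finE | right; exists m => //; apply/unbE].
Qed.
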